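(* Let $n,p\ge 1$, $q=n+p$, $\tau\in[0,1]$ and $c>0$. Let $z=[x^T\; y^T]^T$ with $x\in\mathbb{R}^n$, $y\in\mathbb{R}^p$, and let the nominal density $f$ of $z$ be Gaussian with mean $m_z=[m_x^T\; m_y^T]^T$ and positive definite covariance $K_z=\begin{bmatrix}K_x & K_{xy}\\ K_{yx} & K_y\end{bmatrix}$. Let $\mathcal{B}_\tau=\{\tilde f \text{ Gaussian density on } \mathbb{R}^{q} \text{ with positive definite covariance}: \mathcal{D}_\tau(\tilde f\|f)\le c\}$, let $J(\tilde f,g)=\mathbb{E}_{\tilde f}[\|x-g(y)\|^2]$, and let $\mathcal{G}$ be the set of estimators $g:\mathbb{R}^p\to\mathbb{R}^n$ such that $\mathbb{E}_{\tilde f}[\|g(y)\|^2]<\infty$ for every $\tilde f\in\mathcal{B}_\tau$. Consider the minimax problem $\min_{g\in\mathcal{G}}\max_{\tilde f\in\mathcal{B}_\tau} J(\tilde f,g)$. Then the optimal robust estimator (solution of this minimax problem) is the Bayes estimator based on $f$, $$g^\circ(y)=G^\circ(y-m_y)+m_x,\qquad G^\circ=K_{xy}K_y^{-1}.$$ The least favorable density $\tilde f^\circ\in\mathcal{B}_\tau$ is Gaussian with mean $\tilde m_z^\circ=m_z$ and covariance $$\tilde K_z^\circ=\begin{bmatrix}\tilde K_x & K_{xy}\\ K_{yx} & K_y\end{bmatrix},$$ i.e. only the covariance of $x$ is perturbed with respect to the nominal covariance. The estimation error $x-g^\circ(y)$ has zero mean under both $f$ and $\tilde f^\circ$, with covariance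 under $f$ and under $\tilde f^\circ$ respectively $$P=K_x-K_{xy}K_y^{-1}K_{yx},\qquad \tilde P=\tilde K_x-K_{xy}K_y^{-1}K_{yx}.$$ Moreover, writing $P=L_PL_P^T$, $$\tilde P=\begin{cases} L_P\left(I_n-\frac{1-\tau}{\lambda}L_P^TL_P\right)^{\frac{1}{\tau-1}}L_P^T, & 0\le\tau<1,\\ L_P\exp\left(\frac{1}{\lambda}L_P^TL_P\right)L_P^T, & \tau=1,\end{cases}$$ where $\lambda>(1-\tau)\|P\|$ is the unique Lagrange multiplier such that $\mathcal{D}_\tau(\tilde f^\circ\|f)=c$.
   Context: For $v\in\mathbb{R}^q$ and a symmetric matrix $A$, $\|v\|_A^2=v^TAv$; $\|P\|$ is the spectral norm (largest singular value); for a positive definite matrix, $\log$ and real powers are the matrix logarithm and matrix power. For Gaussian densities $\tilde f$ (mean $\tilde m_z$, covariance $\tilde K_z\succ0$) and $f$ (mean $m_z$, covariance $K_z\succ 0$) on $\mathbb{R}^q$, let $\Delta m_z=\tilde m_z-m_z$, let $L_z$ be any matrix with $K_z=L_zL_z^T$ and $M=L_z^{-1}\tilde K_zL_z^{-T}$. The $\tau$ divergence is $\mathcal{D}_\tau(\tilde f\|f)=\|\Delta m_z\|^2_{K_z^{-1}}+\mathrm{tr}\left(-\log(\tilde K_zK_z^{-1})+\tilde K_zK_z^{-1}-I_q\right)$ for $\tau=0$; $\mathcal{D}_\tau(\tilde f\|f)=\frac{1}{1-\tau}\|\Delta m_z\|^2_{K_z^{-1}}+\mathrm{tr}\left(\frac{1}{\tau(\tau-1)}M^\tau+\frac{1}{1-\tau}\tilde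 K_zK_z^{-1}+\frac1\tau I_q\right)$ for $0<\tau<1$; $\mathcal{D}_\tau(\tilde f\|f)=\delta(\Delta m_z)+\mathrm{tr}\left(M\log M-\tilde K_zK_z^{-1}+I_q\right)$ for $\tau=1$, where $\delta(\Delta m_z)$ equals $0$ if $\Delta m_z=0$ and $+\infty$ otherwise. *)

(* Defs.v *)
From mathcomp Require Import all_boot all_order all_algebra.
From mathcomp Require Import all_classical all_reals all_analysis.
Import numFieldNormedType.Exports.
Set Implicit Arguments. Unset Strict Implicit. Unset Printing Implicit Defensive.
Import Order.TTheory GRing.Theory Num.Theory.
Local Open Scope ring_scope.
Local Open Scope classical_set_scope.

Section Defs.
Variable R : realType.

Definition sqn k (v : 'cV[R]_k) : R := (v^T *m v) 0 0.

Definition posdef k (A : 'M[R]_k) : Prop :=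
  A^T = A /\ forall v : 'cV[R]_k, v != 0 -> 0 < (v^T *m A *m v) 0 0.

Definition specnorm k l (A : 'M[R]_(k, l)) : R :=
  sup [set Num.sqrt (sqn (A *m v)) | v in [set v : 'cV[R]_l | sqn v = 1]].

(** primary matrix function of a diagonalizable matrix:
    f(A) = V diag(f(d)) V^{-1} whenever A = V diag(d) V^{-1}
    (independent of the chosen diagonalization). *)
Definition mxfun k (f : R -> R) (A : 'M[R]_k) : 'M[R]_k :=
  xget 0 [set B | exists (V : 'M[R]_k) (d : 'rV[R]_k),
     [/\ V \in unitmx, A = V *m diag_mx d *m invmx V &
         B = V *m diag_mx (map_mx f d) *m invmx V]].

Definition mxlog k (A : 'M[R]_k) := mxfun (@ln R) A.
Definition mxexp k (A : 'M[R]_k) := mxfun (@expR R) A.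
Definition mxpow k (A : 'M[R]_k) (r : R) := mxfun (fun x => x `^ r) A.

Definition Ddiv k (tau : R) (mt : 'cV[R]_k) (Kt : 'M[R]_k)
    (m : 'cV[R]_k) (K : 'M[R]_k) : \bar R :=
  let dm := mt - m in
  let nrm := (dm^T *m invmx K *m dm) 0 0 in
  let L := xget 0 [set L : 'M[R]_k | K = L *m L^T] in
  let M := invmx L *m Kt *m (invmx L)^T in
  let T := Kt *m invmx K in
  if tau == 0 then (nrm + \tr (- mxlog T + T - 1%:M))%:E
  else if tau < 1 then
    ((1 - tau)^-1 * nrm
     + \tr ((tau * (tau - 1))^-1 *: mxpow M tau + (1 - tau)^-1 *: T
            + tau^-1 *: 1%:M))%:E
  else ((if dm == 0%R then 0%E else +oo%E) + (\tr (M *m mxlog M - T + 1%:M))%:E)%E.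

Definition gauss k (m : 'cV[R]_k) (K : 'M[R]_k) (z : 'cV[R]_k) : R :=
  expR (- ((z - m)^T *m invmx K *m (z - m)) 0 0 / 2)
  / Num.sqrt ((2 * pi) ^+ k * \det K).

(** Lebesgue integral over R^k, as iterated integral over the coordinates *)
Definition setc k (z : 'cV[R]_k) (j : nat) (t : R) : 'cV[R]_k :=
  \col_i (if (i : nat) == j then t else z i 0).

Fixpoint iint k (j : nat) (F : 'cV[R]_k -> \bar R) (z : 'cV[R]_k)
  {struct j} : \bar R :=
  match j with
  | 0 => F z
  | j'.+1 => (\int[@lebesgue_measure R]_t iint j' F (setc z j' t))%E
  end.

Definition lebint k (F : 'cV[R]_k -> \bar R) : \bar R := iint k F 0.

Definition gexp k (m : 'cV[R]_k) (K : 'M[R]_k) (h : 'cV[R]_k -> R) : \bar R :=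
  lebint (fun z => (h z * gauss m K z)%:E).

Definition borel k (A : set 'cV[R]_k) : Prop :=
  smallest (sigma_algebra setT) (@open 'cV[R]_k) A.
Definition borel_fun k l (g : 'cV[R]_k -> 'cV[R]_l) : Prop :=
  forall U : set 'cV[R]_l, open U -> borel (g @^-1` U).

(** the ambiguity ball B_tau around the nominal Gaussian N(m,K);
    a Gaussian density is represented by its (mean, covariance) *)
Definition inBall k (tau c : R) (m : 'cV[R]_k) (K : 'M[R]_k)
    (mt : 'cV[R]_k) (Kt : 'M[R]_k) : Prop :=
  posdef Kt /\ (Ddiv tau mt Kt m K <= c%:E)%E.

Definition Jcost n p (mt : 'cV[R]_(n + p)) (Kt : 'M[R]_(n + p))
    (g : 'cV[R]_p -> 'cV[R]_n) : \bar R :=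
  gexp mt Kt (fun z => sqn (usubmx z - g (dsubmx z))).

Definition worst_case n p (tau c : R) (m : 'cV[R]_(n + p)) (K : 'M[R]_(n + p))
    (g : 'cV[R]_p -> 'cV[R]_n) : \bar R :=
  ereal_sup [set e | exists mt Kt, inBall tau c m K mt Kt /\ e = Jcost mt Kt g].

Definition estimators n p (tau c : R) (m : 'cV[R]_(n + p)) (K : 'M[R]_(n + p))
    (g : 'cV[R]_p -> 'cV[R]_n) : Prop :=
  borel_fun g /\
  forall mt Kt, inBall tau c m K mt Kt ->
    (gexp mt Kt (fun z => sqn (g (dsubmx z))) < +oo)%E.

Definition Pformula n (tau lam : R) (LP : 'M[R]_n) : 'M[R]_n :=
  if tau < 1 then
    LP *m mxpow (1%:M - ((1 - tau) / lam) *: (LP^T *m LP)) (tau - 1)^-1 *m LP^T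
  else LP *m mxexp (lam^-1 *: (LP^T *m LP)) *m LP^T.

End Defs.

(* Main.v *)
(** The nominal error e = x - g°(y) is independent of y, so in the coordinates
    (e, y) the nominal covariance is diag(P, K_y).  Whitening these coordinates,
    the cost of g° at a density of the ball becomes a linear functional
    tr(C M) + u^T C u of the whitened covariance M and mean shift u, where
    C = diag(mu, 0) carries the eigenvalues of P, while the divergence becomes
    |u|^2 / (1 - tau) + tr phi(M) for a convex scalar function phi.  Klein's
    inequality tr phi(M) >= tr phi(M0) + tr phi'(M0)(M - M0) at the matrix M0
    with phi'(M0) = C / lambda gives the least favorable covariance.  It only
    changes P, hence leaves the conditional mean g° unchanged, and g° is
    the Bayes estimator for the least favorable density.  The multiplier lambda
    comes from the intermediate value theorem and strict monotonicity in
    1 / lambda. *)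

Require Import Defs.
From mathcomp Require Import all_boot all_order all_algebra.
From mathcomp Require Import all_classical all_reals all_analysis measurable_realfun.
From mathcomp Require Import ring lra.
From mathcomp Require spectral complex.
Import numFieldNormedType.Exports.
Import Order.TTheory GRing.Theory Num.Theory.
Local Open Scope ring_scope.
Local Open Scope classical_set_scope.
Set Implicit Arguments. Unset Strict Implicit. Unset Printing Implicit Defensive.

(** * Positive definite matrices *)

Section PosDef.
Variable R : realType.

(** A covariance in the ball need not commute with [M0], so the two are compared through the
    orthogonal matrix that relates two square roots of the nominal covariance; its squared entries
    turn Klein's inequality into averages of scalar tangent inequalities. Two features of [dphi]
    shape the answer. Since [dphi tau 1 = 0], the zero entries of C on the y-coordinates correspond
    to eigenvalue 1 of [M0], which is why only the covariance of x moves. Since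
    [(1 - tau) * dphi tau x < 1], the entries of C stay below [lambda / (1 - tau)] when [tau < 1],
    so a mean shift costs more divergence than it gains in error; at [tau = 1] a shift has infinite
    divergence. Integrals are iterated with x inside and y outside, so conditioning on y reduces
    every Gaussian expectation to moments on the line. *)

Lemma posdef_unit k (A : 'M[R]_k) : posdef A -> A \in unitmx.
Proof.
move=> [_ pA]; rewrite unitmxE unitfE; apply/det0P => -[v v0 vA].
have := pA v^T; rewrite trmx_eq0 => /(_ v0).
by rewrite trmxK vA mul0mx mxE ltxx.
Qed.

Lemma posdef1 k : posdef (1%:M : 'M[R]_k).
Proof.
split=> [|v v0]; first by rewrite trmx1.
rewrite mulmx1 mxE lt0r sumr_ge0 ?andbT; last first.
  by move=> i _; rewrite mxE -expr2 sqr_ge0.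
apply: contraNneq v0 => /psumr_eq0P v0; apply/eqP/matrixP => i j.
rewrite !ord1 mxE; apply/eqP; rewrite -sqrf_eq0 expr2.
by have := v0 _ i isT; rewrite mxE => -> // l _; rewrite mxE -expr2 sqr_ge0.
Qed.

Lemma posdef_congr k (A X : 'M[R]_k) :
  posdef A -> X \in unitmx -> posdef (X *m A *m X^T).
Proof.
move=> [sA pA] uX; split=> [|v v0]; first by rewrite !trmx_mul trmxK sA mulmxA.
have := pA (X^T *m v); rewrite trmx_mul trmxK !mulmxA; apply.
apply: contraNneq v0 => /(congr1 (mulmx (invmx X^T))).
by rewrite mulKmx ?unitmx_tr// mulmx0 => ->.
Qed.

Lemma posdef_diag k (d : 'rV[R]_k) : (forall i, 0 < d 0 i) -> posdef (diag_mx d).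
Proof.
move=> d0; pose s := diag_mx (map_mx Num.sqrt d).
have -> : diag_mx d = s *m 1%:M *m s^T.
  rewrite mulmx1 tr_diag_mx mulmx_diag; congr diag_mx.
  by apply/rowP => i; rewrite !mxE -expr2 sqr_sqrtr// ltW.
apply: posdef_congr; first exact: posdef1.
rewrite unitmxE det_diag unitfE; apply/prodf_neq0 => i _.
by rewrite mxE gt_eqF// sqrtr_gt0.
Qed.

Lemma posdef_diag_gt0 k (d : 'rV[R]_k) : posdef (diag_mx d) -> forall i, 0 < d 0 i.
Proof.
move=> [_ pd] i; have := pd (delta_mx i 0).
have -> : (delta_mx i 0 : 'cV[R]_k) != 0.
  by apply/eqP => /matrixP/(_ i 0)/eqP; rewrite !mxE !eqxx oner_eq0.
move=> /(_ isT); rewrite trmx_delta -rowE mxE (bigD1 i)//= !mxE !eqxx mulr1 mulr1n.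
rewrite big1 ?addr0// => j ji; rewrite !mxE (negbTE ji) mulr0//.
Qed.

(** * Block elimination and the Schur complement *)

Section Block.
Variables (n p : nat).
Variables (Kx : 'M[R]_n) (Kxy : 'M[R]_(n, p)) (Kyx : 'M[R]_(p, n)) (Ky : 'M[R]_p).

(** Sends [(e, y)] to [(e + G y, y)]: for [G = Kxy *m invmx Ky] it rebuilds the centred x from the
    estimation error and the centred y. *)
Definition ushear (G : 'M[R]_(n, p)) : 'M[R]_(n + p) := block_mx 1%:M G 0 1%:M.

Lemma ushear_det G : \det (ushear G) = 1.
Proof. by rewrite det_ublock !det1 mulr1. Qed.

Lemma ushear_unit G : ushear G \in unitmx.
Proof. by rewrite unitmxE ushear_det unitr1. Qed.

Lemma ushear_inv G : invmx (ushear G) = ushear (- G).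
Proof.
rewrite -[RHS](mulKmx (ushear_unit G)) mulmx_block.
by rewrite !mul1mx !mulmx0 !mulmx1 !mul0mx !addr0 !add0r addNr -scalar_mx_block mulmx1.
Qed.

Lemma posdef_diag_block (P : 'M[R]_n) : posdef P -> posdef Ky -> posdef (block_mx P 0 0 Ky).
Proof.
move=> [sP pP] [sY pY]; split; first by rewrite tr_block_mx sP sY !trmx0.
move=> v; rewrite -(vsubmxK v); set x := usubmx v; set y := dsubmx v => v0.
rewrite tr_col_mx mul_row_block mul_row_col !mulmx0 addr0 add0r mxE.
have [x0|x0] := eqVneq x 0; last first.
  rewrite ltr_pwDl ?pP//; have [->|y0] := eqVneq y 0; last by rewrite ltW ?pY.
  by rewrite mulmx0 mxE.
rewrite x0 mulmx0 mxE add0r pY//.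
by apply: contraNneq v0 => ->; rewrite x0 col_mx0.
Qed.

Lemma block_shear (P : 'M[R]_n) (G : 'M[R]_(n, p)) :
  ushear G *m block_mx P 0 0 Ky *m (ushear G)^T =
  block_mx (P + G *m Ky *m G^T) (G *m Ky) (Ky *m G^T) Ky.
Proof.
rewrite /ushear tr_block_mx !trmx1 !trmx0 !mulmx_block.
by rewrite !(mul1mx, mulmx1, mulmx0, mul0mx, addr0, add0r).
Qed.

Hypothesis pK : posdef (block_mx Kx Kxy Kyx Ky).

Lemma posdef_block_sym : [/\ Kx^T = Kx, Kyx^T = Kxy, Kxy^T = Kyx & Ky^T = Ky].
Proof.
by have [] := pK; rewrite tr_block_mx => /eq_block_mx[].
Qed.

Lemma posdef_dr : posdef Ky.
Proof.
have [_ _ _ sY] := posdef_block_sym; split=> // v v0; have [_] := pK.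
move=> /(_ (col_mx 0 v)); rewrite col_mx_eq0 negb_and v0 orbT => /(_ isT).
rewrite tr_col_mx trmx0 mul_row_block mul_row_col !mul0mx !mulmx0 !add0r//.
Qed.

Let G := Kxy *m invmx Ky.

Lemma posdef_block_shear :
  block_mx Kx Kxy Kyx Ky =
  ushear G *m block_mx (Kx - Kxy *m invmx Ky *m Kyx) 0 0 Ky *m (ushear G)^T.
Proof.
have [sX _ sYX sY] := posdef_block_sym; have uY := posdef_unit posdef_dr.
rewrite block_shear /G trmx_mul trmx_inv sY sYX !mulmxA mulmxKV// mulmxV// mul1mx.
by rewrite subrK.
Qed.

(** Congruence by the inverse shear makes the covariance block diagonal; its first block is then
    tested on vectors [col_mx v 0]. *)
Lemma posdef_schur : posdef (Kx - Kxy *m invmx Ky *m Kyx).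
Proof.
set P := _ - _; suff pPY : posdef (block_mx P 0 0 Ky).
  have [sPY pd] := pPY; split; first by move: sPY; rewrite tr_block_mx => /eq_block_mx[].
  move=> v v0; have := pd (col_mx v 0); rewrite col_mx_eq0 negb_and v0 => /(_ isT).
  by rewrite tr_col_mx trmx0 mul_row_block mul_row_col !mulmx0 !addr0.
have := posdef_congr pK (ushear_unit (- G)); rewrite posdef_block_shear.
by rewrite -ushear_inv trmx_inv !mulmxA mulVmx ?ushear_unit// mul1mx mulmxK// unitmx_tr ushear_unit.
Qed.

Lemma posdef_block_det :
  \det (block_mx Kx Kxy Kyx Ky) = \det (Kx - Kxy *m invmx Ky *m Kyx) * \det Ky.
Proof.
by rewrite posdef_block_shear !det_mulmx det_tr ushear_det mul1r mulr1 det_ublock.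
Qed.

End Block.
End PosDef.

(** * Simultaneous diagonalization *)

Section Spectral.
Import complex.
Variable R : realType.

(* When [G] is the Gram matrix [V *m V^T] of a basis [V] diagonalizing a symmetric
   matrix as [diag_mx d], the factor [L] commuting with [diag_mx d] turns [V] into
   the orthonormal eigenbasis [invmx L *m V]. *)
Lemma cholesky_comm k (G : 'M[R]_k) (d : 'rV[R]_k) :
  posdef G -> G *m diag_mx d = diag_mx d *m G ->
  exists L : 'M[R]_k, [/\ L \in unitmx, G = L *m L^T &
                          L *m diag_mx d = diag_mx d *m L].
Proof.
elim: k G d => [|k IH] G d pG.
  move=> _; exists 1%:M; split; first exact: unitmx1.
    by apply/matrixP => -[].
  by rewrite mulmx1 mul1mx.
rewrite -(@submxK _ 1 k 1 k G) -(@hsubmxK _ 1 1 k d) (@diag_mx_row _ k 1).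
set Kx := ulsubmx _; set Kxy := ursubmx _; set Kyx := dlsubmx _; set Ky := drsubmx _.
set d0 := diag_mx _; set d' := rsubmx _.
rewrite !(@mulmx_block _ 1 k 1 k 1 k) !mulmx0 !mul0mx !addr0 !add0r.
move=> /(@eq_block_mx _ 1 k 1 k)[_ dxy _ dy].
have pK : posdef (block_mx Kx Kxy Kyx Ky) by rewrite (@submxK _ 1 k 1 k G).
have pY := posdef_dr pK; have uY := posdef_unit pY.
have [L' [uL KyE Ld]] := IH _ _ pY dy.
have := posdef_block_shear pK; set U := Kxy *m invmx Ky => KE.
have := posdef_schur pK; rewrite -/U in KE *; set P := _ - _ => -[_ pP].
have P0 : 0 < P 0 0.
  have := pP 1%:M; rewrite trmx1 mul1mx mulmx1; apply.
  by apply/eqP => /matrixP/(_ 0 0)/eqP; rewrite !mxE oner_eq0.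
pose s := Num.sqrt (P 0 0).
pose E : 'M[R]_(1 + k) := block_mx s%:M 0 0 L'.
have EE : E *m E^T = block_mx P 0 0 Ky.
  rewrite tr_block_mx !trmx0 mulmx_block !mulmx0 !mul0mx !addr0 !add0r.
  by rewrite -KyE tr_scalar_mx -scalar_mxM -expr2 sqr_sqrtr ?ltW// -mx11_scalar.
exists (ushear U *m E); split.
- rewrite unitmx_mul (@ushear_unit _ 1 k) unitmxE (@det_ublock _ 1 k) det_scalar1 unitrM.
  by rewrite -unitmxE uL unitfE gt_eqF// sqrtr_gt0.
- by rewrite trmx_mul !mulmxA -(mulmxA _ E) EE; exact: KE.
(* The off-diagonal block of the commutation hypothesis intertwines [Kxy], and [invmx Ky] commutes
   with [diag_mx d'] because [Ky] does. *)
- have Ud : U *m diag_mx d' = d0 *m U.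
    rewrite mulmxA -dxy /U -!mulmxA; congr (_ *m _).
    by rewrite -[RHS](mulKmx uY) [Ky *m _]mulmxA dy mulmxK.
  rewrite /ushear /E !(@mulmx_block _ 1 k 1 k 1 k) !mulmx0 !mul0mx !mul1mx.
  rewrite !addr0 !add0r -Ld mulmxA -Ud -!mulmxA Ld scalar_mxC.
  by rewrite mul0mx mulmx0.
Qed.

(** Over the complex numbers [A] is Hermitian, hence diagonalizable with real spectrum, and real
    matrices similar over the complex field are similar over the reals. This descent does not keep
    the basis orthonormal. *)
Lemma sym_diagonalizable k (A : 'M[R]_k) : A^T = A ->
  exists (V : 'M[R]_k) (d : 'rV[R]_k), V \in unitmx /\ V *m A = diag_mx d *m V.
Proof.
move=> sA; pose f : {rmorphism R -> complex.complex R} := complex.real_complex R.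
have real_f k1 k2 (B : 'M[R]_(k1, k2)) : map_mx f B \is a mxOver Num.real.
  by apply/mxOverP => i j; rewrite mxE; apply/complex.complex_realP; exists (B i j).
have real_fP k1 k2 (B : 'M[complex.complex R]_(k1, k2)) : B \is a mxOver Num.real ->
    exists B', B = map_mx f B'.
  move=> /mxOverP rB; exists (map_mx (@complex.Re R) B).
  by apply/matrixP => i j; rewrite !mxE; rewrite [RHS]complex.RRe_real.
have sfA : map_mx f A \is sesquilinear.symmetricmx.
  apply/sesquilinear.is_hermitianmxP.
  rewrite expr0 scale1r map_trmx sA.
  by rewrite map_mx_id.
have hA := spectral.realsym_hermsym sfA (real_f _ _ _).
have /spectral.hermitian_normalmx/spectral.orthomx_spectralP AE := hA.
have /real_fP[d dE] := spectral.hermitian_spectral_diag_real hA.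
have sAd : exists2 P, P \in unitmx & mxred.similar P (map_mx f A) (map_mx f (diag_mx d)).
  exists (spectral.spectralmx (map_mx f A)); first exact: spectral.spectral_unit.
  apply/mxred.similarP; first exact: spectral.spectral_unit.
  by rewrite {2}AE map_diag_mx -dE !mulmxA mulmxV ?mul1mx// spectral.spectral_unit.
have [Q] := spectral.real_similar sAd (real_f _ _ _) (real_f _ _ _).
rewrite inE => /andP[/real_fP[V ->]]; rewrite map_unitmx => uV.
move=> /(mxred.similarP); rewrite map_unitmx => /(_ uV); rewrite -!map_mxM => /map_mx_inj VA.
by exists V, d.
Qed.

(** [S] is a factor [L] of [K] rotated by the orthonormal eigenvectors of
    [invmx L *m Kt *m (invmx L)^T]. With [K = 1%:M] this is the spectral theorem, with [Kt = K] it
    provides a square root. *)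
Lemma simdiag k (K Kt : 'M[R]_k) : posdef K -> posdef Kt ->
  exists (S : 'M[R]_k) (d : 'rV[R]_k), [/\ S \in unitmx, forall i, 0 < d 0 i,
    K = S *m S^T & Kt = S *m diag_mx d *m S^T].
Proof.
move=> pK pKt.
have [|L [uL KE _]] := @cholesky_comm _ K (const_mx 1) pK.
  by rewrite diag_const_mx mulmx1 mul1mx.
have uLt : L^T \in unitmx by rewrite unitmx_tr.
move AD: (invmx L *m Kt *m (invmx L)^T) => A.
have pA : posdef A by rewrite -AD; apply: posdef_congr; rewrite ?unitmx_inv.
have [V [d [uV VA]]] := sym_diagonalizable pA.1.
have uVt : V^T \in unitmx by rewrite unitmx_tr.
have pG : posdef (V *m V^T).
  by rewrite -[V in V *m _]mulmx1; apply: posdef_congr => //; exact: posdef1.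
(* The Gram matrix commutes with [diag_mx d], as the transpose of [VA] shows. *)
have [|W [uW GE Wd]] := @cholesky_comm _ _ d pG.
  have := congr1 trmx VA; rewrite trmx_mul pA.1 trmx_mul tr_diag_mx => VA'.
  by rewrite -mulmxA -VA' [LHS]mulmxA VA mulmxA.
have uWt : W^T \in unitmx by rewrite unitmx_tr.
have dWt : diag_mx d *m W^T = W^T *m diag_mx d.
  by have := congr1 trmx Wd; rewrite !trmx_mul tr_diag_mx.
pose U := invmx W *m V.
have UU : U *m U^T = 1%:M.
  by rewrite /U trmx_mul trmx_inv mulmxA -(mulmxA _ V) GE mulKmx// mulmxV.
have UtU : U^T *m U = 1%:M by exact: mulmx1C.
have UAE : U *m A = diag_mx d *m U.
  rewrite /U -mulmxA VA !mulmxA; congr (_ *m _).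
  by rewrite -[RHS](mulKmx uW) [W *m _]mulmxA Wd mulmxK.
have AE : A = U^T *m diag_mx d *m U by rewrite -mulmxA -UAE mulmxA UtU mul1mx.
clearbody U; exists (L *m U^T), d; split.
- by rewrite unitmx_mul uL unitmx_tr; case/mulmx1_unit: UU.
- apply: posdef_diag_gt0; have := posdef_congr pA (X := U).
  rewrite UAE -mulmxA UU mulmx1; apply; by case/mulmx1_unit: UU.
- by rewrite trmx_mul trmxK mulmxA -(mulmxA L) UtU mulmx1.
- rewrite trmx_mul trmxK !mulmxA -(mulmxA L) -(mulmxA L) -AE -AD.
  by rewrite !mulmxA mulmxV// mul1mx -mulmxA -trmx_mul mulmxV// trmx1 mulmx1.
Qed.

End Spectral.

(** * The scalar functions of the divergence *)

Section Scalar.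
Variables (R : realType) (tau : R).

(* The covariance part of [Ddiv] is the trace of [phi]; [dphi] is the derivative
   of [phi], and [xi] the inverse of [dphi]. *)
Definition phi (x : R) : R :=
  if tau == 0 then - ln x + x - 1
  else if tau < 1 then (tau * (tau - 1))^-1 * x `^ tau + (1 - tau)^-1 * x + tau^-1
  else x * ln x - x + 1.

Definition dphi (x : R) : R :=
  if tau < 1 then (1 - tau)^-1 * (1 - x `^ (tau - 1)) else ln x.

Definition xi (s : R) : R :=
  if tau < 1 then (1 - (1 - tau) * s) `^ (tau - 1)^-1 else expR s.

Lemma powR_expR (x r : R) : 0 < x -> x `^ r = expR (r * ln x).
Proof. by move=> x0; rewrite /powR gt_eqF. Qed.

Lemma ln_le_sub1 (x : R) : 0 < x -> ln x <= x - 1.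
Proof. by move=> x0; have := expR_ge1Dx (ln x); rewrite lnK ?posrE//; lra. Qed.

Hypothesis tau01 : 0 <= tau <= 1.

Lemma tau_ge1 : ~~ (tau < 1) -> tau = 1.
Proof. by move: tau01 => /andP[_ ?]; rewrite -leNgt => ?; apply/eqP; rewrite eq_le; apply/andP. Qed.

Lemma phi1 : phi 1 = 0.
Proof.
rewrite /phi ln1 powR1; have [_|t0] := eqVneq tau 0; first by lra.
case: ltP => t1; last by lra.
have ? : tau - 1 != 0 by rewrite subr_eq0 lt_eqF.
have ? : 1 - tau != 0 by rewrite subr_eq0 gt_eqF.
by field; do ?[apply/andP; split].
Qed.

Lemma phi_tangent (x y : R) : 0 < x -> 0 < y -> phi y + dphi y * (x - y) <= phi x.
Proof.
move=> x0 y0; have xy0 : 0 < x / y by rewrite divr_gt0.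
have lnxy : ln (x / y) = ln x - ln y by rewrite lnM ?posrE ?invr_gt0// lnV ?posrE.
rewrite /phi /dphi; have [->|t0] := eqVneq tau 0.
  rewrite ltr01 !(sub0r, subr0) invr1 mul1r (powR_inv1 (ltW y0)).
  have := ln_le_sub1 xy0; rewrite lnxy.
  have -> : (1 - y^-1) * (x - y) = x - y - x / y + 1 by field; rewrite gt_eqF.
  lra.
case: ltP => t1; last first.
  have := ln_le_sub1 (divr_gt0 y0 x0); rewrite lnM ?posrE ?invr_gt0// lnV ?posrE//.
  move=> /(ler_wpM2l (ltW x0)).
  have -> : x * (y / x - 1) = y - x by field; rewrite gt_eqF.
  nra.
have tp : 0 < tau by rewrite lt_neqAle eq_sym t0; case/andP: tau01.
have t1p : 0 < 1 - tau by rewrite subr_gt0.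
have : (x / y) `^ tau <= tau * (x / y) + (1 - tau).
  have := @conjugate_powR _ ((x / y) `^ tau) 1 tau^-1 (1 - tau)^-1.
  rewrite powR_ge0 ler01 !invr_gt0 tp t1p !invrK mulr1 addrC subrK powR1.
  rewrite -powRrM mulfV// powRr1 ?(ltW xy0)// mul1r [_ * tau]mulrC.
  by apply.
have yt0 : 0 < y `^ tau by rewrite powR_gt0.
have -> : (x / y) `^ tau = x `^ tau / y `^ tau.
  by rewrite powRM ?invr_ge0 ?(ltW x0) ?(ltW y0)// -(powR_inv1 (ltW y0)) -powRrM mulN1r powRN.
have -> : y `^ (tau - 1) = y `^ tau / y.
  rewrite powRD; last by rewrite (gt_eqF y0) implybT.
  by rewrite (powR_inv1 (ltW y0)).
rewrite ler_pdivrMr// => h.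
rewrite -subr_ge0; set lhs := (X in 0 <= X).
have -> : lhs = (tau * (1 - tau))^-1 * ((tau * (x / y) + (1 - tau)) * y `^ tau - x `^ tau).
  rewrite /lhs; field.
  by rewrite t0 (gt_eqF y0) (gt_eqF t1p) subr_eq0 (lt_eqF t1).
by rewrite mulr_ge0 ?subr_ge0// invr_ge0 mulr_ge0 ?ltW.
Qed.

Lemma xi_gt0 s : (1 - tau) * s < 1 -> 0 < xi s.
Proof. by rewrite /xi; case: ifP => _ s1; rewrite ?expR_gt0// powR_gt0// subr_gt0. Qed.

Lemma xi0 : xi 0 = 1.
Proof. by rewrite /xi mulr0 subr0 powR1 expR0; case: ifP. Qed.

Lemma dphi_xi s : (1 - tau) * s < 1 -> dphi (xi s) = s.
Proof.
rewrite /dphi /xi; case: (ltP tau 1) => t1 s1; last by rewrite expRK.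
have t1p : 1 - tau != 0 by rewrite subr_eq0 gt_eqF.
have t1n : tau - 1 != 0 by rewrite subr_eq0 lt_eqF.
rewrite -powRrM mulVf// powRr1; last by rewrite subr_ge0 ltW.
by field.
Qed.

(** Values of [dphi] lie in the domain of [xi]; the same bound later controls the mean shift. *)
Lemma dphi_dom x : 0 < x -> (1 - tau) * dphi x < 1.
Proof.
rewrite /dphi => x0; case: ifPn => t1; last by rewrite (tau_ge1 t1) subrr mul0r.
by rewrite mulrA mulfV ?mul1r ?subr_eq0 ?gt_eqF// gtrBl powR_gt0.
Qed.

Lemma xi_dphi x : 0 < x -> xi (dphi x) = x.
Proof.
rewrite /dphi /xi => x0; case: (ltP tau 1) => t1; last by rewrite lnK ?posrE.
have t1n : tau - 1 != 0 by rewrite subr_eq0 lt_eqF.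
rewrite mulrA mulfV ?mul1r ?subr_eq0 ?gt_eqF// opprB addrC subrK.
by rewrite -powRrM mulfV// (powRr1 (ltW x0)).
Qed.

Lemma xi_lt s s' : s < s' -> (1 - tau) * s' < 1 -> xi s < xi s'.
Proof.
rewrite /xi; case: ifPn => t1 ss s1; last by rewrite ltr_expR.
have t1p : 0 < 1 - tau by rewrite subr_gt0.
have ss1 : (1 - tau) * s < (1 - tau) * s' by rewrite ltr_pM2l.
rewrite !powR_expR ?subr_gt0//; last exact: lt_trans s1.
rewrite ltr_expR ltr_nM2l ?invr_lt0 ?subr_lt0// ltr_ln ?posrE ?subr_gt0//.
  by rewrite ltrD2l ltrN2.
exact: lt_trans s1.
Qed.

(** The tangent to [phi] at [xi s] has slope [s > 0], and [xi] is increasing. *)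
Lemma phi_xi_lt s s' : 0 < s -> s < s' -> (1 - tau) * s' < 1 -> phi (xi s) < phi (xi s').
Proof.
move=> s0 ss s1; have s1' : (1 - tau) * s < 1.
  apply: le_lt_trans s1; rewrite ler_wpM2l ?(ltW ss)// subr_ge0.
  by case/andP: tau01.
apply: lt_le_trans (phi_tangent (xi_gt0 s1) (xi_gt0 s1')).
by rewrite dphi_xi// ltrDl mulr_gt0// subr_gt0 xi_lt.
Qed.

Lemma phi_xi_ge0 s : (1 - tau) * s < 1 -> 0 <= phi (xi s).
Proof.
move=> s1; have := phi_tangent (xi_gt0 s1) ltr01; rewrite phi1.
rewrite (_ : dphi 1 = 0) ?mul0r ?addr0//.
by rewrite /dphi ln1 powR1 subrr mulr0; case: ifP.
Qed.

Lemma phi_unbounded (c : R) : exists2 X, 1 < X & c <= phi X.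
Proof.
have d2 : 0 < dphi 2.
  rewrite /dphi; case: ifPn => t1; last by rewrite ln_gt0// ltr1n.
  rewrite mulr_gt0 ?invr_gt0 ?subr_gt0// powR_expR// -[ltRHS]expR0 ltr_expR.
  by rewrite nmulr_rlt0 ?subr_lt0// ln_gt0// ltr1n.
(* The tangent at 2 has positive slope; [Y] is where it reaches [c], or 2 if it is already there. *)
pose Y := 2 + Num.max 0 ((c - phi 2) / dphi 2).
have Y2 : 2 <= Y by rewrite lerDl le_max lexx.
exists Y; first by apply: lt_le_trans Y2; rewrite ltr1n.
have Y0 : 0 < Y by apply: lt_le_trans Y2.
apply: le_trans (phi_tangent Y0 (ltr0Sn _ 1)).
rewrite -lerBlDl mulrC -ler_pdivrMr// lerBrDl /Y lerD2l.
by rewrite le_max lexx orbT.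
Qed.

Lemma continuous_phi x : 0 < x -> {for x, continuous phi}.
Proof.
move=> x0; have cln := continuous_ln x0; rewrite /phi.
case: (tau == 0).
  by apply: cvgB; [apply: cvgD => //; exact: cvgN|exact: cvg_cst].
case: (tau < 1); last first.
  apply: cvgD; last exact: cvg_cst.
  by apply: cvgB => //; apply: cvgM.
apply: cvgD; last exact: cvg_cst.
apply: cvgD; last by apply: cvgM => //; exact: cvg_cst.
apply: cvgM; first exact: cvg_cst.
suff : (fun y => expR (tau * ln y)) @ x --> x `^ tau.
  apply: cvg_trans; apply: near_eq_cvg.
  by near=> y; rewrite powR_expR//; near: y; exact: (cvgr_gt _ cvg_id).
rewrite powR_expR//; apply: (@continuous_comp _ _ _ (fun y => tau * ln y) expR).
  by apply: cvgM => //; exact: cvg_cst.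
exact: continuous_expR.
Unshelve. all: by end_near. Qed.

Lemma continuous_xi s : (1 - tau) * s < 1 -> {for s, continuous xi}.
Proof.
move=> s1; rewrite /xi; case: (tau < 1); last exact: continuous_expR.
have cb : (fun t => 1 - (1 - tau) * t) @ s --> 1 - (1 - tau) * s.
  by apply: cvgB; [exact: cvg_cst|apply: cvgM => //; exact: cvg_cst].
have b0 : 0 < 1 - (1 - tau) * s by rewrite subr_gt0.
rewrite /continuous_at.
suff : (fun t => expR ((tau - 1)^-1 * ln (1 - (1 - tau) * t))) @ s -->
    (1 - (1 - tau) * s) `^ (tau - 1)^-1.
  apply: cvg_trans; apply: near_eq_cvg; near=> t; rewrite powR_expR//; near: t.
  exact: (cvgr_gt _ cb).
rewrite powR_expR//.
apply: (@continuous_comp _ _ _ (fun t => (tau - 1)^-1 * ln (1 - (1 - tau) * t)) expR).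
  apply: cvgM; first exact: cvg_cst.
  apply: (@continuous_comp _ _ _ (fun t => 1 - (1 - tau) * t) (@ln R)) => //.
  exact: continuous_ln.
exact: continuous_expR.
Unshelve. all: by end_near. Qed.

Lemma continuous_phi_xi s : (1 - tau) * s < 1 -> {for s, continuous (phi \o xi)}.
Proof.
by move=> s1; apply: continuous_comp; [exact: continuous_xi|apply/continuous_phi/xi_gt0].
Qed.

End Scalar.

(** * The divergence in terms of eigenvalues *)

Section Divergence.
Variable R : realType.

(** For two diagonalizations, [X = invmx W *m V] intertwines the diagonals: entrywise, [X i j] is
    zero or the eigenvalues [e 0 i] and [d 0 j] agree. Hence [X] also intertwines their images under
    [f]. *)
Lemma mxfunE k (f : R -> R) (V : 'M[R]_k) (d : 'rV[R]_k) : V \in unitmx ->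
  mxfun f (V *m diag_mx d *m invmx V) = V *m diag_mx (map_mx f d) *m invmx V.
Proof.
move=> uV; rewrite /mxfun; case: xgetP => [B _ [W [e [uW AE ->]]]|]; last first.
  by move=> /(_ (V *m diag_mx (map_mx f d) *m invmx V))[]; exists V, d.
pose X := invmx W *m V.
have dX : diag_mx e *m X = X *m diag_mx d.
  transitivity (invmx W *m (W *m diag_mx e *m invmx W *m V)).
    by rewrite /X !mulmxA mulVmx// mul1mx.
  by rewrite -AE mulmxKV// /X mulmxA.
have dfX : diag_mx (map_mx f e) *m X = X *m diag_mx (map_mx f d).
  apply/matrixP => i j; have := congr1 (fun A : 'M[R]_k => A i j) dX.
  rewrite !mul_diag_mx !mul_mx_diag !mxE mulrC => /eqP.
  rewrite -subr_eq0 -mulrBr mulf_eq0 => /orP[/eqP->|]; first by rewrite mulr0 mul0r.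
  by rewrite subr_eq0 => /eqP ->; rewrite mulrC.
transitivity (W *m (diag_mx (map_mx f e) *m X) *m invmx V).
  by rewrite /X !mulmxA mulmxK.
by rewrite dfX /X !mulmxA mulmxV// mul1mx.
Qed.

Lemma invmx_gram k (S : 'M[R]_k) : S \in unitmx -> invmx (S *m S^T) = (invmx S)^T *m invmx S.
Proof.
move=> uS; have uSS : S *m S^T \in unitmx by rewrite unitmx_mul uS unitmx_tr.
rewrite -[LHS]mulmx1 -[RHS](mulKmx uSS); congr (_ *m _).
rewrite -mulmxA [S^T *m _]mulmxA -trmx_mul mulVmx// trmx1 mul1mx mulmxV//.
Qed.

Lemma gram_quad k (S : 'M[R]_k) (v : 'cV[R]_k) : S \in unitmx ->
  (v^T *m invmx (S *m S^T) *m v) 0 0 = sqn (invmx S *m v).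
Proof. by move=> uS; rewrite /sqn invmx_gram// trmx_mul !mulmxA. Qed.

(** The factor picked by [xget] is arbitrary but differs from [S] by an orthogonal [W], so both [M]
    and [T] have spectrum [d]. At [tau = 1] the convention [0^-1 = 0] removes the mean term, which
    is correct in the finite branch since the means coincide there. *)
Lemma Ddiv_eig k tau (mt m : 'cV[R]_k) (S : 'M[R]_k) (d : 'rV[R]_k) :
  0 <= tau <= 1 -> S \in unitmx -> (forall i, 0 < d 0 i) ->
  Ddiv tau mt (S *m diag_mx d *m S^T) m (S *m S^T) =
  if (tau < 1) || (mt == m)
  then ((1 - tau)^-1 * sqn (invmx S *m (mt - m)) + \sum_i phi tau (d 0 i))%:E
  else +oo%E.
Proof.
move=> tau01 uS d0; rewrite /Ddiv; set L := xget _ _.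
have LL : S *m S^T = L *m L^T by rewrite /L; case: xgetP => // /(_ S)[].
have uL : L \in unitmx.
  have : S *m S^T \in unitmx by rewrite unitmx_mul uS unitmx_tr.
  by rewrite LL unitmx_mul => /andP[].
have -> : S *m diag_mx d *m S^T *m invmx (S *m S^T) = S *m diag_mx d *m invmx S.
  by rewrite invmx_gram// mulmxA -(mulmxA _ S^T) -trmx_mul mulVmx// trmx1 mulmx1.
have trS (e : 'rV[R]_k) : \tr (S *m diag_mx e *m invmx S) = \sum_i e 0 i.
  by rewrite mxtrace_mulC mulKmx// mxtrace_diag.
pose W := invmx L *m S.
have uW : W \in unitmx by rewrite unitmx_mul unitmx_inv uL.
have WW : W *m W^T = 1%:M.
  by rewrite /W trmx_mul mulmxA -(mulmxA _ S) LL mulKmx// -trmx_mul mulVmx// trmx1.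
have WtE : W^T = invmx W by rewrite -[LHS](mulKmx uW) WW mulmx1.
have -> : invmx L *m (S *m diag_mx d *m S^T) *m (invmx L)^T = W *m diag_mx d *m invmx W.
  by rewrite -WtE /W trmx_mul !mulmxA.
clearbody W; have trW (e : 'rV[R]_k) : \tr (W *m diag_mx e *m invmx W) = \sum_i e 0 i.
  by rewrite mxtrace_mulC mulKmx// mxtrace_diag.
rewrite gram_quad// /mxlog /mxpow !mxfunE//.
have tr1 : \tr (1%:M : 'M[R]_k) = \sum_(i < k) 1 by rewrite mxtrace1 sumr_const card_ord.
rewrite /phi; have [->|t0] := eqVneq tau 0.
  rewrite ltr01 subr0 invr1 mul1r; congr (_ + _)%:E.
  rewrite !raddfD/= !raddfN/= !trS tr1 -!sumrN -!big_split/=.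
  by apply: eq_bigr => i _; rewrite mxE.
case: ltP => t1 /=.
  congr (_ + _)%:E; rewrite !raddfD/= !mxtraceZ trS trW tr1 !mulr_sumr -!big_split/=.
  by apply: eq_bigr => i _; rewrite mxE mulr1.
have -> : tau = 1 by apply: tau_ge1 => //; rewrite -leNgt.
rewrite subr_eq0; case: eqP => [->|_]; last by rewrite addye.
rewrite add0e subrr invr0 mul0r add0r; congr (_%:E).
have -> : W *m diag_mx d *m invmx W *m (W *m diag_mx (map_mx (@ln R) d) *m invmx W) =
          W *m diag_mx (\row_i (d 0 i * ln (d 0 i))) *m invmx W.
  rewrite !mulmxA mulmxKV// -(mulmxA W) mulmx_diag.
  by congr (_ *m diag_mx _ *m _); apply/rowP => i; rewrite !mxE.
rewrite !raddfD/= !raddfN/= trS trW tr1 -!sumrN -!big_split/=.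
by apply: eq_bigr => i _; rewrite mxE.
Qed.

Lemma sqnE k (v : 'cV[R]_k) : sqn v = \sum_i v i 0 ^+ 2.
Proof. by rewrite /sqn mxE; apply: eq_bigr => i _; rewrite mxE expr2. Qed.

Lemma sqn_ge0 k (v : 'cV[R]_k) : 0 <= sqn v.
Proof. by rewrite sqnE sumr_ge0// => i _; exact: sqr_ge0. Qed.

(* Klein's inequality: for O orthogonal, the weights [O j i ^+ 2] are doubly
   stochastic, which reduces the matrix inequality to [phi_tangent]. *)
Lemma ball_bound k tau lam c (mt m : 'cV[R]_k) (Kt S0 : 'M[R]_k) (C e : 'rV[R]_k) :
  0 <= tau <= 1 -> 0 < lam -> S0 \in unitmx -> (forall j, 0 < e 0 j) ->
  (forall j, C 0 j = lam * dphi tau (e 0 j)) ->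
  posdef Kt -> (Ddiv tau mt Kt m (S0 *m S0^T) <= c%:E)%E ->
  c = \sum_j phi tau (e 0 j) ->
  let u := invmx S0 *m (mt - m) in
  let N := invmx S0 *m Kt *m (invmx S0)^T in
  (u^T *m diag_mx C *m u) 0 0 + \tr (diag_mx C *m N) <= \sum_j C 0 j * e 0 j.
Proof.
move=> tau01 lam0 uS0 e0 CE pKt Dc cE; cbv zeta; move: Dc.
have pK : posdef (S0 *m S0^T).
  by rewrite -[S0 in S0 *m _]mulmx1; apply: posdef_congr => //; exact: posdef1.
have [S [d [uS d0 KE ->]]] := simdiag pK pKt.
set u := invmx S0 *m _; set N := invmx S0 *m _ *m _.
(* [S] and [S0] are factors of the same matrix, so [O] is orthogonal. *)
rewrite KE Ddiv_eig//; set O := invmx S0 *m S.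
have OO : O *m O^T = 1%:M.
  rewrite /O trmx_mul mulmxA -(mulmxA _ S) -KE mulmxA mulVmx// mul1mx.
  by rewrite -trmx_mul mulVmx// trmx1.
have NE : N = O *m diag_mx d *m O^T by rewrite /N /O trmx_mul !mulmxA.
have uE : sqn (invmx S *m (mt - m)) = sqn u by rewrite -!gram_quad// KE.
have u0 : mt = m -> u = 0 by rewrite /u => ->; rewrite subrr mulmx0.
clearbody O N u.
have OtO : O^T *m O = 1%:M by exact: mulmx1C.
have Orow j : \sum_i O j i ^+ 2 = 1.
  have := congr1 (fun A : 'M[R]_k => A j j) OO; rewrite !mxE eqxx mulr1n => <-.
  by apply: eq_bigr => i _; rewrite mxE expr2.
have Ocol i : \sum_j O j i ^+ 2 = 1.
  have := congr1 (fun A : 'M[R]_k => A i i) OtO; rewrite !mxE eqxx mulr1n => <-.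
  by apply: eq_bigr => j _; rewrite mxE expr2.
have trN : \tr (diag_mx C *m N) = \sum_j \sum_i O j i ^+ 2 * (C 0 j * d 0 i).
  apply: eq_bigr => j _; rewrite mul_diag_mx mxE NE mxE mulr_sumr.
  by apply: eq_bigr => i _; rewrite mul_mx_diag !mxE; ring.
have quadE : (u^T *m diag_mx C *m u) 0 0 = \sum_j C 0 j * u j 0 ^+ 2.
  rewrite mxE; apply: eq_bigr => j _; rewrite mul_mx_diag !mxE; ring.
rewrite uE quadE trN cE.
have sumO (F : 'I_k -> R) : \sum_j F j = \sum_j \sum_i O j i ^+ 2 * F j.
  by apply: eq_bigr => j _; rewrite -mulr_suml Orow mul1r.
have sumO' (F : 'I_k -> R) : \sum_i F i = \sum_j \sum_i O j i ^+ 2 * F i.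
  by rewrite exchange_big; apply: eq_bigr => i _; rewrite -mulr_suml Ocol mul1r.
case: ifPn => // h; rewrite lee_fin => Dc.
(* For [tau < 1], [dphi_dom] gives [C 0 j <= lam / (1 - tau)]; otherwise the means agree and
   [u = 0]. *)
have quad_le : \sum_j C 0 j * u j 0 ^+ 2 <= lam * ((1 - tau)^-1 * sqn u).
  case/orP: h => [t1|/eqP mtm]; last first.
    rewrite u0// /sqn mulmx0 mxE !mulr0 big1// => j _.
    by rewrite mxE expr0n mulr0.
  rewrite sqnE !mulr_sumr; apply: ler_sum => j _; rewrite [leRHS]mulrA.
  apply: ler_wpM2r; first exact: sqr_ge0.
  rewrite CE ler_pM2l// -[leRHS]mul1r ler_pdivlMr ?subr_gt0// mulrC ltW//.
  exact: dphi_dom.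
have klein : \sum_j \sum_i O j i ^+ 2 * (C 0 j * d 0 i) - \sum_j C 0 j * e 0 j <=
    lam * (\sum_i phi tau (d 0 i) - \sum_j phi tau (e 0 j)).
  rewrite (sumO (fun j => C 0 j * _)) (sumO (fun j => phi tau (e 0 j))).
  rewrite (sumO' (fun i => phi tau (d 0 i))).
  rewrite -!sumrB mulr_sumr; apply: ler_sum => j _.
  rewrite -!sumrB mulr_sumr; apply: ler_sum => i _.
  rewrite -!mulrBr [leRHS]mulrCA; apply: ler_wpM2l; first exact: sqr_ge0.
  rewrite CE -mulrA ler_pM2l// lerBrDl; exact: phi_tangent.
(* The divergence budget scaled by [lam]; it absorbs the right-hand sides of [quad_le] and [klein]
   together. *)
have : lam * ((1 - tau)^-1 * sqn u + \sum_i phi tau (d 0 i) - \sum_j phi tau (e 0 j)) <= 0.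
  by rewrite pmulr_rle0// subr_le0.
move: klein quad_le; lra.
Qed.

End Divergence.

(** * Moments of the normal density on the line *)

Section Line.
Variable R : realType.
Notation mu := (@lebesgue_measure R).

(** The integral of a nonnegative function is a supremum over the simple functions below it, so
    monotonicity holds even for partial integrals of an arbitrary estimator. *)
Lemma ge0_integral_le (f g : R -> \bar R) :
  (forall x, 0 <= f x)%E -> (forall x, f x <= g x)%E ->
  (\int[mu]_x f x <= \int[mu]_x g x)%E.
Proof.
move=> f0 fg; have g0 x : (0 <= g x)%E by exact: le_trans (f0 x) (fg x).
rewrite !ge0_integralTE//; apply: le_ereal_sup => _ [h hf <-]; exists h => // x.
exact: le_trans (hf x) (fg x).
Qed.

Lemma FTC2_line (f F : R -> R) : continuous f -> mu.-integrable setT (EFin \o f) ->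
  (forall x : R, is_derive x 1 F (f x)) ->
  (F n.+1%:R - F (- n.+1%:R)) @[n --> \oo] --> 0 ->
  (\int[mu]_x (f x)%:E = 0)%E.
Proof.
(* Dominated convergence along growing intervals; [n.+1] keeps each of them nondegenerate. *)
move=> cf intf dF F0; pose D n : set R := `[- n.+1%:R, n.+1%:R]%classic.
pose fn n (x : R) : \bar R := (f x * \1_(D n) x)%:E.
have mf : measurable_fun setT f by exact: continuous_measurable_fun.
have [] := @dominated_convergence _ (measurableTypeR R) _ mu setT measurableT fn (EFin \o f)
  (fun x => `|(f x)%:E|%E).
- move=> n; apply/measurable_EFinP; apply: measurable_funM.
    exact: continuous_measurable_fun.
  by apply: measurable_indic; exact: measurable_itv.
- exact/measurable_EFinP.
- apply: aeW => x _; apply: cvg_near_cst; near=> n; rewrite /fn indicE mem_set ?mulr1//.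
  rewrite /D/= in_itv/= -ler_norml (le_trans _ (_ : n%:R <= _))// ?ler_nat//.
  near: n; exact: nbhs_infty_ger.
- exact: integrable_abse intf.
- apply: aeW => x n _; rewrite /fn abse_EFin lee_fin normrM indicE ler_piMr//.
  by case: (_ \in _); rewrite ?normr1 ?normr0.
move=> _ _ cvI; apply: (cvg_unique _ cvI) => //.
rewrite (_ : [sequence _]_n = fun n => (F n.+1%:R - F (- n.+1%:R))%:E).
  by apply: cvg_EFin; [exact: nearW|exact: F0].
apply/funext => n /=; under eq_integral do rewrite /fn.
rewrite (_ : (fun x => _) = (EFin \o f) \_ (D n)); last first.
  by apply/funext => x; rewrite patchE indicE; case: (_ \in _); rewrite ?mulr1 ?mulr0.
rewrite -integral_mkcond.
have cF x : {for x, continuous F}.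
  by have [dFx _] := dF x; exact/differentiable_continuous/derivable1_diffP.
rewrite (@continuous_FTC2 _ f F) ?EFinB//.
- by rewrite -subr_gt0 opprK -natrD ltr0n.
- exact: continuous_subspaceT.
- split; [by move=> x _; have [] := dF x| |].
  + exact/cvg_at_right_filter/cF.
  + exact/cvg_at_left_filter/cF.
- by move=> x _; rewrite derive1E; have [] := dF x.
Unshelve. all: by end_near. Qed.

(** * Moments up to order two, from explicit antiderivatives *)

Section Moments.
Variables (m s : R).
Hypothesis s0 : 0 < s.
Notation p := (normal_pdf m s).

Lemma expR_mul_le1 (u : R) : 0 <= u -> u * expR (- u) <= 1.
Proof.
move=> u0; rewrite expRN ler_pdivrMr ?expR_gt0// mul1r.
by apply: le_trans (expR_ge1Dx u); rewrite lerDr.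
Qed.

Lemma normal_pdf_sqr_le x :
  (x - m) ^+ 2 * p x <= normal_peak s * (2 * s ^+ 2).
Proof.
have s1 : s != 0 by rewrite gt_eqF.
rewrite normal_pdfE// mulrCA ler_pM2l ?normal_peak_gt0// /normal_fun.
pose u := (x - m) ^+ 2 / (s ^+ 2 *+ 2).
have u0 : 0 <= u by rewrite divr_ge0 ?sqr_ge0// mulrn_wge0// sqr_ge0.
rewrite [expR _](_ : _ = expR (- u)); last by rewrite /u mulNr.
rewrite [leLHS](_ : _ = 2 * s ^+ 2 * (u * expR (- u))); last by rewrite /u; field.
by rewrite ler_piMr ?expR_mul_le1// mulr_ge0 ?sqr_ge0.
Qed.

Lemma continuous_shift : continuous (fun x : R => x - m).
Proof. by move=> x; apply: cvgB; [exact: cvg_id|exact: cvg_cst]. Qed.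

Lemma integrable_normal_sqr : mu.-integrable setT (EFin \o (fun x => (x - m) ^+ 2 * p x)).
Proof.
have s1 : s != 0 by rewrite gt_eqF.
(* Doubling the variance halves the exponent; the other half absorbs the quadratic factor through
   [u * expR (- u) <= 1]. *)
pose s' := Num.sqrt 2 * s.
have s'1 : s' != 0 by rewrite mulf_neq0// gt_eqF// sqrtr_gt0.
have s'2 : s' ^+ 2 = 2 * s ^+ 2 by rewrite exprMn sqr_sqrtr.
pose K := normal_peak s * (4 * s ^+ 2) / normal_peak s'.
apply: (@le_integrable _ _ _ mu setT measurableT _ (fun x => K%:E * (normal_pdf m s' x)%:E)%E).
- apply/measurable_EFinP; apply: continuous_measurable_fun => x.
  apply: cvgM; last exact: continuous_normal_pdf.
  apply: (@continuous_comp _ _ _ (fun x => x - m) (fun x : R => x ^+ 2)).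
    exact: continuous_shift.
  exact: exprn_continuous.
- move=> x _; rewrite /= ?lee_fin !ger0_norm; last 2 first.
  + rewrite mulr_ge0 ?normal_pdf_ge0// divr_ge0 ?normal_peak_ge0//.
    by rewrite mulr_ge0 ?normal_peak_ge0// mulr_ge0// sqr_ge0.
  + by rewrite mulr_ge0 ?sqr_ge0 ?normal_pdf_ge0.
  rewrite !normal_pdfE//= /K [leRHS]mulrA divfK ?gt_eqF ?normal_peak_gt0//.
  rewrite mulrCA -[leRHS]mulrA ler_pM2l ?normal_peak_gt0// /normal_fun s'2.
  pose u := (x - m) ^+ 2 / (4 * s ^+ 2).
  have u0 : 0 <= u by rewrite divr_ge0 ?sqr_ge0// mulr_ge0// sqr_ge0.
  rewrite [in leLHS](_ : - _ / _ = - u - u); last by rewrite /u; field.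
  rewrite [in leRHS](_ : - _ / _ = - u); last by rewrite /u; field.
  rewrite expRD [leLHS](_ : _ = 4 * s ^+ 2 * (u * expR (- u) * expR (- u))).
    rewrite ler_pM2l ?mulr_gt0 ?exprn_gt0//.
    by rewrite ler_piMl ?expR_ge0// expR_mul_le1.
  by rewrite /u; field.
- by apply: integrableZl => //; exact: integrable_normal_pdf.
Qed.

Lemma integrable_normal_lin : mu.-integrable setT (EFin \o (fun x => (x - m) * p x)).
Proof.
have s1 : s != 0 by rewrite gt_eqF.
apply: (@le_integrable _ _ _ mu setT measurableT _
  (fun x => (p x)%:E + ((x - m) ^+ 2 * p x)%:E)%E).
- apply/measurable_EFinP; apply: continuous_measurable_fun => x.
  by apply: cvgM; [exact: continuous_shift|exact: continuous_normal_pdf].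
- move=> x _; rewrite /= ?lee_fin -{2}[p x]mul1r -mulrDl !normrM.
  apply: ler_wpM2r => //; rewrite [leRHS]ger0_norm ?addr_ge0 ?sqr_ge0//.
  have := sqr_ge0 (x - m); have := sqr_ge0 (x - m - 1); have := sqr_ge0 (x - m + 1).
  by have [|] := ger0P (x - m); rewrite !expr2; lra.
- by apply: integrableD => //; [exact: integrable_normal_pdf|exact: integrable_normal_sqr].
Qed.

Lemma is_derive_normal_pdf (x : R) : is_derive x 1 p (- (x - m) / s ^+ 2 * p x).
Proof.
have s1 : s != 0 by rewrite gt_eqF.
rewrite normal_pdfE//.
have d1 : is_derive x 1 (fun y : R => - (y - m) ^+ 2 / (s ^+ 2 *+ 2)) (- (x - m) / s ^+ 2).
  have -> : (fun y : R => - (y - m) ^+ 2 / (s ^+ 2 *+ 2)) =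
     (- (s ^+ 2 *+ 2)^-1) \*: (fun y : R => y - m) ^+ 2.
    by apply/funext => y; rewrite /= /GRing.scale/= mulNr mulrC mulNr.
  apply: is_derive_eq; rewrite /GRing.scale /=; by field.
have d2 : is_derive x 1 (normal_fun m s) (normal_fun m s x * (- (x - m) / s ^+ 2)).
  exact: (@is_derive1_comp _ expR (fun y : R => - (y - m) ^+ 2 / (s ^+ 2 *+ 2))).
have -> : (fun x => normal_peak s * normal_fun m s x) = normal_peak s \*: normal_fun m s.
  by apply/funext.
by apply: is_derive_eq; rewrite /GRing.scale/=; ring.
Qed.

Lemma cvg_tail_diff (G : R -> R) (C : R) :
  (forall x, 1 <= `|x - m| -> `|G x| * `|x - m| <= C) ->
  (G n.+1%:R - G (- n.+1%:R)) @[n --> \oo] --> 0.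
Proof.
move=> GC; have C0 : 0 <= C.
  have := GC (m + 1); rewrite addrC addKr normr1 mulr1 => /(_ (lexx _)).
  exact: le_trans.
apply/cvgr0Pnorm_le => e e0; near=> n.
(* The first threshold ensures [1 <= |x - m|], the second makes [C / |x - m|] at most [e / 2]. *)
have [N1 N2] : `|m| + 1 <= n%:R /\ `|m| + 2 * C / e <= n%:R.
  by split; near: n; exact: nbhs_infty_ger.
have half x : `|x| = n.+1%:R -> `|G x| <= e / 2.
  move=> xn; have xm : n%:R - `|m| <= `|x - m|.
    apply: le_trans (lerB_dist x m); rewrite lerD2r xn ler_nat//.
  have xm1 : 1 <= `|x - m| by apply: le_trans xm; rewrite lerBrDl.
  have xm0 : 0 < `|x - m| by apply: lt_le_trans xm1.
  rewrite -(ler_pM2r xm0); apply: le_trans (GC _ xm1) _.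
  have : 2 * C / e <= `|x - m| by apply: le_trans xm; rewrite lerBrDl.
  by rewrite ler_pdivrMr// => h; rewrite mulrAC ler_pdivlMr// mulrC [e * _]mulrC.
rewrite (le_trans (ler_normB _ _))// [leRHS]splitr lerD// half//.
by rewrite normr_nat.
by rewrite normrN normr_nat.
Unshelve. all: by end_near. Qed.

Lemma integral_normal_lin : (\int[mu]_x ((x - m) * p x)%:E = 0)%E.
Proof.
have s1 : s != 0 by rewrite gt_eqF.
apply: (@FTC2_line (fun x => (x - m) * p x) ((- s ^+ 2) \*: p)).
- by move=> x; apply: cvgM; [exact: continuous_shift|exact: continuous_normal_pdf].
- exact: integrable_normal_lin.
- move=> x; have dp := is_derive_normal_pdf x.
  by apply: is_derive_eq; rewrite /GRing.scale/=; field.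
- apply: (@cvg_tail_diff _ (s ^+ 2 * (normal_peak s * (2 * s ^+ 2)))) => x x1.
  rewrite /GRing.scale/= normrM normrN (ger0_norm (sqr_ge0 s)) -mulrA.
  apply: ler_wpM2l; first exact: sqr_ge0.
  apply: le_trans (normal_pdf_sqr_le x).
  rewrite (ger0_norm (normal_pdf_ge0 _ _ _)) mulrC ler_wpM2r ?normal_pdf_ge0//.
  by rewrite -real_normK ?num_real// expr2 ler_peMr.
Qed.

(** Once [s ^+ 2] is subtracted, the integrand is the exact derivative of
    [- s ^+ 2 * (x - m) * p x]. *)
Lemma integral_normal_var : (\int[mu]_x (((x - m) ^+ 2 - s ^+ 2) * p x)%:E = 0)%E.
Proof.
have s1 : s != 0 by rewrite gt_eqF.
apply: (@FTC2_line (fun x => ((x - m) ^+ 2 - s ^+ 2) * p x)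
  ((- s ^+ 2) \*: ((fun x => x - m) * p))).
- move=> x; apply: cvgM; last exact: continuous_normal_pdf.
  apply: cvgB; last exact: cvg_cst.
  apply: (@continuous_comp _ _ _ (fun x => x - m) (fun x : R => x ^+ 2)).
    exact: continuous_shift.
  exact: exprn_continuous.
- rewrite (_ : _ \o _ = (fun x => ((x - m) ^+ 2 * p x)%:E - (s ^+ 2)%:E * (p x)%:E)%E).
    apply: integrableB => //; first exact: integrable_normal_sqr.
    by apply: integrableZl => //; exact: integrable_normal_pdf.
  by apply/funext => x; rewrite /= mulrBl.
- move=> x; have dp := is_derive_normal_pdf x.
  by apply: is_derive_eq; rewrite /GRing.scale/=; field.
- apply: (@cvg_tail_diff _ (s ^+ 2 * (normal_peak s * (2 * s ^+ 2)))) => x x1.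
  rewrite /GRing.scale/= normrM normrN (ger0_norm (sqr_ge0 s)) -mulrA.
  apply: ler_wpM2l; first exact: sqr_ge0.
  apply: le_trans (normal_pdf_sqr_le x).
  rewrite normrM (ger0_norm (normal_pdf_ge0 _ _ _)) mulrAC -expr2.
  by rewrite real_normK ?num_real.
Qed.

Lemma integral_normal_quad (a b c : R) :
  (\int[mu]_x ((a + b * (x - m) + c * (x - m) ^+ 2) * p x)%:E = (a + c * s ^+ 2)%:E)%E.
Proof.
have ip := integrable_normal_pdf m s.
have il := integrable_normal_lin.
have iv : mu.-integrable setT (EFin \o (fun x => ((x - m) ^+ 2 - s ^+ 2) * p x)).
  rewrite (_ : _ \o _ = (fun x => ((x - m) ^+ 2 * p x)%:E - (s ^+ 2)%:E * (p x)%:E)%E).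
    apply: integrableB => //; first exact: integrable_normal_sqr.
    exact: integrableZl.
  by apply/funext => x; rewrite /= mulrBl.
under eq_integral => x _.
  rewrite (_ : (_ * _)%:E = (a + c * s ^+ 2)%:E * (p x)%:E +
    (b%:E * ((x - m) * p x)%:E + c%:E * (((x - m) ^+ 2 - s ^+ 2) * p x)%:E))%E; last first.
    by rewrite -!EFinM -!EFinD; congr (_%:E); ring.
  over.
rewrite integralD//=; last 2 first.
- exact: integrableZl.
- by apply: integrableD => //; exact: integrableZl.
rewrite integralD//=; last 2 first.
- exact: integrableZl.
- exact: integrableZl.
rewrite !integralZl// integral_normal_pdf integral_normal_lin integral_normal_var.
by rewrite !mule0 !adde0 mule1.
Qed.

End Moments.
End Line.

(** * Iterated integrals and multivariate Gaussian densities *)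

Section Iterated.
Variable R : realType.
Notation mu := (@lebesgue_measure R).

Lemma iint_ge0 k j (F : 'cV[R]_k -> \bar R) z : (forall x, 0 <= F x)%E -> (0 <= iint j F z)%E.
Proof. by move=> F0; elim: j z => [|j IH] z //=; apply: integral_ge0 => t _. Qed.

Lemma iint_le k j (F1 F2 : 'cV[R]_k -> \bar R) z :
  (forall x, 0 <= F1 x)%E -> (forall x, F1 x <= F2 x)%E -> (iint j F1 z <= iint j F2 z)%E.
Proof.
move=> F0 F12; elim: j z => [|j IH] z //=; apply: ge0_integral_le => t.
  exact: iint_ge0.
exact: IH.
Qed.

Lemma iint_local k j (F : 'cV[R]_k -> \bar R) (z z' : 'cV[R]_k) :
  (forall i : 'I_k, (j <= i)%N -> z i 0 = z' i 0) -> iint j F z = iint j F z'.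
Proof.
elim: j z z' => [|j IH] z z' zz /=.
  by congr F; apply/matrixP => i l; rewrite ord1 zz.
apply: eq_integral => t _; apply: IH => i ji; rewrite !mxE; case: eqP => // /eqP ij.
by apply: zz; rewrite ltn_neqAle eq_sym ij.
Qed.

Lemma eq_iint k j (F1 F2 : 'cV[R]_k -> \bar R) : F1 =1 F2 -> iint j F1 =1 iint j F2.
Proof.
by move=> F12 z; elim: j z => [|j IH] z //=; apply: eq_integral => t _; exact: IH.
Qed.

Lemma eq_lebint k (F1 F2 : 'cV[R]_k -> \bar R) : F1 =1 F2 -> lebint F1 = lebint F2.
Proof. by move=> F12; exact: eq_iint. Qed.

Lemma le_lebint k (F1 F2 : 'cV[R]_k -> \bar R) :
  (forall x, 0 <= F1 x)%E -> (forall x, F1 x <= F2 x)%E -> (lebint F1 <= lebint F2)%E.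
Proof. exact: iint_le. Qed.

Lemma usubmx_setc_lt n p (z : 'cV[R]_(n + p)) j t : (j < n)%N ->
  usubmx (setc z j t) = setc (usubmx z) j t /\ dsubmx (setc z j t) = dsubmx z.
Proof.
move=> jn; split; apply/matrixP => i l; rewrite ord1 !mxE//=.
case: eqP => // ij; suff : (n + i < n)%N by rewrite ltnNge leq_addr.
by rewrite ij.
Qed.

Lemma usubmx_setc_ge n p (z : 'cV[R]_(n + p)) j t :
  usubmx (setc z (n + j) t) = usubmx z /\ dsubmx (setc z (n + j) t) = setc (dsubmx z) j t.
Proof.
split; apply/matrixP => i l; rewrite ord1 !mxE//=; last by rewrite eqn_add2l.
by case: eqP => // ij; have := ltn_ord i; rewrite [X in (X < _)%N]ij ltnNge leq_addr.
Qed.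

Lemma iint_inner n p (F : 'cV[R]_(n + p) -> \bar R) j z : (j <= n)%N ->
  iint j F z = iint j (fun x => F (col_mx x (dsubmx z))) (usubmx z).
Proof.
elim: j z => [|j IH] z jn /=; first by rewrite vsubmxK.
apply: eq_integral => t _; rewrite IH 1?ltnW//.
by have [-> ->] := usubmx_setc_lt z t jn.
Qed.

Lemma iint_outer n p (F : 'cV[R]_(n + p) -> \bar R) j z :
  iint (n + j) F z = iint j (fun y => iint n F (col_mx (usubmx z) y)) (dsubmx z).
Proof.
elim: j z => [|j IH] z; first by rewrite addn0/= vsubmxK.
rewrite addnS /=; apply: eq_integral => t _; rewrite IH.
by have [-> ->] := usubmx_setc_ge z j t.
Qed.

(** Coordinate 0 is the innermost variable of [iint], so x is integrated inside and y outside by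
    construction; no exchange of integrals occurs. *)
Lemma lebint_block n p (F : 'cV[R]_(n + p) -> \bar R) :
  lebint F = lebint (fun y => lebint (fun x => F (col_mx x y))).
Proof.
rewrite /lebint iint_outer.
have -> : dsubmx (0 : 'cV[R]_(n + p)) = 0 by apply/matrixP => i j; rewrite !mxE.
apply: eq_iint => y; rewrite iint_inner// col_mxKu col_mxKd.
by apply: iint_local => i; rewrite leqNgt ltn_ord.
Qed.

Lemma lebint1 (F : 'cV[R]_1 -> \bar R) : lebint F = (\int[mu]_t F t%:M)%E.
Proof.
apply: eq_integral => t _ /=; congr F.
by apply/matrixP => i j; rewrite !ord1 !mxE.
Qed.

End Iterated.

(** * Gaussian expectations of quadratic polynomials *)

Section Gauss.
Variable R : realType.

Lemma invmx_eq k (A B : 'M[R]_k) : A *m B = 1%:M -> invmx A = B.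
Proof. by move=> AB; have [uA _] := mulmx1_unit AB; rewrite -[RHS](mulKmx uA) AB mulmx1. Qed.

Lemma quad_congr k (U D : 'M[R]_k) (w : 'cV[R]_k) : U \in unitmx -> D \in unitmx ->
  (U *m w)^T *m invmx (U *m D *m U^T) *m (U *m w) = w^T *m invmx D *m w.
Proof.
move=> uU uD; have uUt : U^T \in unitmx by rewrite unitmx_tr.
rewrite (@invmx_eq _ _ (invmx U^T *m invmx D *m invmx U)); last first.
  by rewrite !mulmxA mulmxK// mulmxK// mulmxV.
by rewrite trmx_mul !mulmxA mulmxK// mulmxKV.
Qed.

Lemma posdef_det_gt0 k (K : 'M[R]_k) : posdef K -> 0 < \det K.
Proof.
move=> pK; have [S [d [uS d0 _ ->]]] := simdiag pK pK.
rewrite !det_mulmx det_tr det_diag mulrAC -expr2 mulr_gt0//.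
  by rewrite exprn_even_gt0//= -unitfE -unitmxE.
by apply: prodr_gt0 => i _.
Qed.

Lemma gauss_gt0 k (m : 'cV[R]_k) K z : posdef K -> 0 < gauss m K z.
Proof.
move=> pK; rewrite /gauss divr_gt0 ?expR_gt0// sqrtr_gt0 mulr_gt0 ?posdef_det_gt0//.
by rewrite exprn_gt0// mulr_gt0 ?pi_gt0.
Qed.

(** Conditional density of x given y times marginal density of y: the shear splits the quadratic
    form and leaves the determinant equal to that of the diagonal blocks. *)
Lemma gauss_block n p (Kx : 'M[R]_n) (Kxy : 'M[R]_(n, p)) Kyx (Ky : 'M[R]_p) mx my x y :
  posdef (block_mx Kx Kxy Kyx Ky) ->
  gauss (col_mx mx my) (block_mx Kx Kxy Kyx Ky) (col_mx x y) =
  gauss (mx + Kxy *m invmx Ky *m (y - my)) (Kx - Kxy *m invmx Ky *m Kyx) x * gauss my Ky y.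
Proof.
move=> pK; have pY := posdef_dr pK; have pP := posdef_schur pK.
have uY := posdef_unit pY; have uP := posdef_unit pP.
rewrite /gauss (posdef_block_det pK) {1}(posdef_block_shear pK).
set P := Kx - _ in pP uP *; set G := Kxy *m invmx Ky.
have uD : block_mx P 0 0 Ky \in unitmx by exact: posdef_unit (posdef_diag_block pP pY).
have -> : col_mx x y - col_mx mx my = ushear G *m col_mx (x - (mx + G *m (y - my))) (y - my).
  rewrite /ushear opp_col_mx add_col_mx mul_block_col mul1mx mul0mx add0r mul1mx.
  by congr col_mx; rewrite opprD addrA subrK.
rewrite quad_congr ?ushear_unit// invmx_block_diag//.
rewrite tr_col_mx mul_row_block mul_row_col !mulmx0 addr0 add0r mxE.
rewrite mulrACA -expRD -invfM -sqrtrM; last first.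
  by rewrite mulr_ge0 ?exprn_ge0 ?mulr_ge0 ?pi_ge0// ltW ?posdef_det_gt0.
by congr (expR _ / Num.sqrt _); [ring|rewrite exprD; ring].
Qed.

Lemma lebint1_gauss_quad (m : 'cV[R]_1) (K : 'M[R]_1) (a b c : R) : posdef K ->
  lebint (fun x => ((a + b * (x - m) 0 0 + c * (x - m) 0 0 ^+ 2) * gauss m K x)%:E) =
  (a + c * K 0 0)%:E.
Proof.
move=> pK; have := posdef_det_gt0 pK; rewrite det_mx11 => K0.
pose s := Num.sqrt (K 0 0); have s0 : 0 < s by rewrite sqrtr_gt0.
have s2 : s ^+ 2 = K 0 0 by rewrite sqr_sqrtr// ltW.
rewrite lebint1 -s2 -(integral_normal_quad (m 0 0) s0 a b c).
apply: eq_integral => t _; have tm : (t%:M - m) 0 0 = t - m 0 0 by rewrite !mxE mulr1n.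
rewrite tm; congr (_ * _)%:E; rewrite normal_pdfE ?gt_eqF//= /normal_peak /normal_fun /gauss.
rewrite [RHS]mulrC det_mx11 expr1 s2; congr (expR _ / Num.sqrt _); last by ring.
have -> : invmx K = ((K 0 0)^-1)%:M.
  by apply: invmx_eq; rewrite [K]mx11_scalar -scalar_mxM mxE mulr1n mulfV ?gt_eqF.
rewrite [_ - m]mx11_scalar tm tr_scalar_mx -!scalar_mxM mxE mulr1n.
by field; rewrite gt_eqF.
Qed.

(** The first coordinate is integrated against its conditional law, where the term linear in its
    deviation vanishes; a quadratic polynomial in [p] variables remains. The dimension stays in the
    form [1 + p] so that the block lemmas apply. *)
Lemma gexp_quad_step p :
  (forall (m : 'cV[R]_p) (K : 'M[R]_p) (a : R) (b : 'cV[R]_p) (C : 'M[R]_p), posdef K ->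
    gexp m K (fun z => a + (b^T *m (z - m)) 0 0 + ((z - m)^T *m C *m (z - m)) 0 0) =
    (a + \tr (C *m K))%:E) ->
  forall (m : 'cV[R]_(1 + p)) (K : 'M[R]_(1 + p)) a (b : 'cV[R]_(1 + p)) (C : 'M[R]_(1 + p)),
    posdef K ->
    gexp m K (fun z => a + (b^T *m (z - m)) 0 0 + ((z - m)^T *m C *m (z - m)) 0 0) =
    (a + \tr (C *m K))%:E.
Proof.
move=> IH m K a b C pK.
rewrite -(submxK K) -(vsubmxK m) in pK *.
move: (ulsubmx K) (ursubmx K) (dlsubmx K) (drsubmx K) pK => Kx Kxy Kyx Ky pK.
move: (usubmx m) (dsubmx m) => mx my.
have pY := posdef_dr pK; have pP := posdef_schur pK.
have KE := posdef_block_shear pK.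
set P := Kx - _ in pP KE; set G := Kxy *m invmx Ky in KE.
(* Coefficients in the decorrelated coordinates. *)
pose b' := (ushear G)^T *m b; pose C' := (ushear G)^T *m C *m ushear G.
rewrite /gexp lebint_block.
transitivity (gexp my Ky (fun y => (a + ulsubmx C' 0 0 * P 0 0) +
   ((dsubmx b')^T *m (y - my)) 0 0 + ((y - my)^T *m drsubmx C' *m (y - my)) 0 0)).
  apply: eq_lebint => y; set v := y - my; set gy := gauss my Ky y.
  pose q := a + ((dsubmx b')^T *m v) 0 0 + (v^T *m drsubmx C' *m v) 0 0.
  pose l := usubmx b' 0 0 + (ursubmx C' *m v) 0 0 + (v^T *m dlsubmx C') 0 0.
  transitivity (lebint (fun x : 'cV_1 => ((q * gy + l * gy * (x - (mx + G *m v)) 0 0 +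
      ulsubmx C' 0 0 * gy * (x - (mx + G *m v)) 0 0 ^+ 2) * gauss (mx + G *m v) P x)%:E)).
    apply: eq_lebint => x; congr (_%:E).
    rewrite (gauss_block _ _ _ _ pK) -/P -/G -/v -/gy.
    set s := x - (mx + G *m v).
    have -> : col_mx x y - col_mx mx my = ushear G *m col_mx s v.
      rewrite /ushear opp_col_mx add_col_mx mul_block_col mul1mx mul0mx add0r mul1mx.
      by congr col_mx; rewrite /s opprD addrA subrK.
    clearbody s; have -> : b^T *m (ushear G *m col_mx s v) = b'^T *m col_mx s v.
      by rewrite /b' trmx_mul trmxK mulmxA.
    have -> : (ushear G *m col_mx s v)^T *m C *m (ushear G *m col_mx s v) =
       (col_mx s v)^T *m C' *m col_mx s v by rewrite /C' trmx_mul !mulmxA.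
    have -> : (b'^T *m col_mx s v) 0 0 = usubmx b' 0 0 * s 0 0 + ((dsubmx b')^T *m v) 0 0.
      rewrite -{1}(vsubmxK b') tr_col_mx mul_row_col mxE; congr (_ + _).
      by rewrite mxE big_ord1 mxE.
    have -> : ((col_mx s v)^T *m C' *m col_mx s v) 0 0 = ulsubmx C' 0 0 * s 0 0 ^+ 2 +
       ((ursubmx C' *m v) 0 0 + (v^T *m dlsubmx C') 0 0) * s 0 0 +
       (v^T *m drsubmx C' *m v) 0 0.
      rewrite -{1}(submxK C') tr_col_mx mul_row_block mul_row_col !mulmxDl.
      rewrite ![fun_of_matrix (_ + _) _ _]mxE.
      rewrite [s]mx11_scalar tr_scalar_mx !mul_mx_scalar !mul_scalar_mx -!scalemxAl.
      by rewrite ![fun_of_matrix (_ *: _) _ _]mxE ?[_%:M 0 0]mxE ?mulr1n; ring.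
    by rewrite /q /l; ring.
  by rewrite lebint1_gauss_quad//; congr (_%:E); rewrite /q; ring.
rewrite IH//; congr (_%:E); rewrite -addrA; congr (_ + _).
rewrite KE !mulmxA [RHS]mxtrace_mulC !mulmxA -/C'.
rewrite -{3}(submxK C') mulmx_block mxtrace_block.
rewrite !mulmx0 addr0 add0r; congr (_ + _).
by rewrite {2}[P]mx11_scalar mul_mx_scalar mxtraceZ /mxtrace big_ord1 mulrC.
Qed.

Lemma gexp_quad k (m : 'cV[R]_k) (K : 'M[R]_k) (a : R) (b : 'cV[R]_k) (C : 'M[R]_k) :
  posdef K ->
  gexp m K (fun z => a + (b^T *m (z - m)) 0 0 + ((z - m)^T *m C *m (z - m)) 0 0) =
  (a + \tr (C *m K))%:E.
Proof.
elim: k m K a b C => [|k IH] m K a b C pK.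
  rewrite /gexp /lebint /= /gauss det_mx00 !mxE !big_ord0 expr0 mulr1 oppr0 mul0r.
  by rewrite expR0 sqrtr1 divr1 mulr1 !addr0 /mxtrace big_ord0 addr0.
exact: gexp_quad_step IH _ _ _ _ _ pK.
Qed.

End Gauss.

(** * Quadratic costs and affine estimators *)

Section Affine.
Variable R : realType.

Lemma continuous_sum_fun (U : topologicalType) (V : normedModType R) (I : Type)
    (r : seq I) (F : I -> U -> V) (x : U) :
  (forall i, {for x, continuous (F i)}) -> {for x, continuous (fun y => \sum_(i <- r) F i y)}.
Proof.
move=> cF; elim: r => [|i r IH].
  rewrite (_ : (fun _ => _) = cst 0); first exact: cvg_cst.
  by apply/funext => y; rewrite big_nil.
rewrite (_ : (fun _ => _) = F i + (fun y => \sum_(j <- r) F j y)).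
  by apply: cvgD; [exact: cF|exact: IH].
by apply/funext => y; rewrite big_cons.
Qed.

Lemma borel_affine p n (G : 'M[R]_(n, p)) (my : 'cV[R]_p) (mx : 'cV[R]_n) :
  borel_fun (fun y : 'cV[R]_p => G *m (y - my) + mx).
Proof.
suff cg : continuous (fun y : 'cV[R]_p => G *m (y - my) + mx).
  by move=> U oU; apply: sub_gen_smallest; exact: open_comp.
have -> : (fun y : 'cV[R]_p => G *m (y - my) + mx) =
    (fun y : 'cV[R]_p => \sum_j y j 0 *: col j G + (mx - G *m my)).
  apply/funext => y; rewrite mulmxBr addrAC addrA; congr (_ + _ - _).
  apply/matrixP => i l; rewrite ord1 mxE summxE; apply: eq_bigr => j _.
  by rewrite !mxE mulrC.
move=> y; pose S (z : 'cV[R]_p) := \sum_j z j 0 *: col j G.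
have cS : {for y, continuous S}.
  apply: continuous_sum_fun => j.
  have cj := @coord_continuous R p 1 j 0 y.
  exact: (@cvgZr_tmp _ _ _ (nbhs y) _ (fun z : 'cV[R]_p => z j 0) (y j 0) (col j G) cj).
exact: (@cvgD _ _ _ (nbhs y) _ S (cst _) _ _ cS (cvg_cst _)).
Qed.

(** Squared bias plus variance. The factor [r] carries the marginal density when y is held fixed. *)
Lemma gexp_sqn k l (m : 'cV[R]_k) (K : 'M[R]_k) (A : 'M[R]_(l, k)) (c : 'cV[R]_l) (r : R) :
  posdef K ->
  gexp m K (fun z => r * sqn (A *m (z - m) + c)) =
  (r * (sqn c + \tr (A *m K *m A^T)))%:E.
Proof.
move=> pK; transitivity (gexp m K (fun z => r * sqn c +
   ((r *: (2 *: (A^T *m c)))^T *m (z - m)) 0 0 +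
   ((z - m)^T *m (r *: (A^T *m A)) *m (z - m)) 0 0)).
  apply: eq_lebint => z; congr ((_ * _)%:E); set w := z - m.
  have -> : ((r *: (2 *: (A^T *m c)))^T *m w) 0 0 = r * (2 * (c^T *m (A *m w)) 0 0).
    by rewrite !linearZ/= trmx_mul trmxK -!scalemxAl ![fun_of_matrix (_ *: _) _ _]mxE mulmxA.
  have -> : (w^T *m (r *: (A^T *m A)) *m w) 0 0 = r * sqn (A *m w).
    by rewrite -scalemxAr -scalemxAl [LHS]mxE /sqn trmx_mul !mulmxA.
  move: (A *m w) => v; rewrite !sqnE mxE !mulr_sumr -!big_split/=.
  by apply: eq_bigr => i _; rewrite !mxE; ring.
rewrite gexp_quad// mulrDr; congr (_ + _)%:E.
by rewrite -scalemxAl mxtraceZ -mulmxA mxtrace_mulC.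
Qed.

End Affine.

(** * The spectral norm and the Lagrange multiplier *)

Section Spectrum.
Variable R : realType.

(** [Q] is an isometry, so only the diagonal factor stretches; the supremum is attained at column
    [i0] of [Q]. *)
Lemma specnorm_diag n (Q : 'M[R]_n) (d : 'rV[R]_n) (i0 : 'I_n) :
  Q *m Q^T = 1%:M -> (forall i, 0 <= d 0 i <= d 0 i0) ->
  specnorm (Q *m diag_mx d *m Q^T) = d 0 i0.
Proof.
move=> QQ d0; have QtQ : Q^T *m Q = 1%:M by exact: mulmx1C.
have d00 : 0 <= d 0 i0 by case/andP: (d0 i0) => /le_trans; apply.
have sqnQ (v : 'cV[R]_n) : sqn (Q *m v) = sqn v.
  by rewrite /sqn trmx_mul mulmxA -(mulmxA v^T) QtQ mulmx1.
have sqnQt (v : 'cV[R]_n) : sqn (Q^T *m v) = sqn v.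
  by rewrite /sqn trmx_mul trmxK mulmxA -(mulmxA v^T) QQ mulmx1.
have sqnP (v : 'cV[R]_n) : sqn (Q *m diag_mx d *m Q^T *m v) = sqn (diag_mx d *m (Q^T *m v)).
  by rewrite -!mulmxA sqnQ.
have ub : ubound [set Num.sqrt (sqn (Q *m diag_mx d *m Q^T *m v)) | v in
    [set v : 'cV[R]_n | sqn v = 1]] (d 0 i0).
  move=> _ [v /= v1 <-]; rewrite sqnP -(sqnQt v) in v1 *.
  move: (Q^T *m v) v1 => {}v v1.
  rewrite -[leRHS]ger0_norm// -sqrtr_sqr ler_wsqrtr// -[leRHS]mulr1 -v1 !sqnE mulr_sumr.
  apply: ler_sum => i _; rewrite mul_diag_mx !mxE exprMn ler_wpM2r ?sqr_ge0//.
  by rewrite !expr2; have /andP[? ?] := d0 i; apply: ler_pM.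
have att : [set Num.sqrt (sqn (Q *m diag_mx d *m Q^T *m v)) | v in
    [set v : 'cV[R]_n | sqn v = 1]] (d 0 i0).
  have sqn_delta (a : R) : sqn (a *: (delta_mx i0 0 : 'cV[R]_n)) = a ^+ 2.
    rewrite sqnE (bigD1 i0)//= !mxE !eqxx mulr1 big1 ?addr0// => i ii0.
    by rewrite !mxE (negbTE ii0) mulr0 expr0n.
  exists (Q *m delta_mx i0 0) => /=.
    by rewrite sqnQ -[delta_mx _ _]scale1r sqn_delta expr1n.
  rewrite sqnP (mulmxA Q^T) QtQ mul1mx.
  have -> : diag_mx d *m delta_mx i0 0 = d 0 i0 *: (delta_mx i0 0 : 'cV[R]_n).
    apply/matrixP => i j; rewrite mul_diag_mx !mxE.
    by have [->//|] := eqVneq i i0; rewrite !mulr0.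
  by rewrite sqn_delta sqrtr_sqr ger0_norm.
apply/eqP; rewrite eq_le; apply/andP; split.
  by apply: ge_sup => //; exists (d 0 i0).
by apply: ub_le_sup => //; exists (d 0 i0).
Qed.

Lemma lagrange_uniq n tau (d : 'rV[R]_n) (i0 : 'I_n) (l l' : R) :
  0 <= tau <= 1 -> (forall i, 0 < d 0 i <= d 0 i0) ->
  (1 - tau) * d 0 i0 < l -> l < l' ->
  \sum_i phi tau (xi tau (d 0 i / l')) < \sum_i phi tau (xi tau (d 0 i / l)).
Proof.
move=> tau01 d0 dl ll'; have d00 : 0 < d 0 i0 by case/andP: (d0 i0).
have t1 : 0 <= 1 - tau by rewrite subr_ge0; case/andP: tau01.
have l0 : 0 < l by apply: le_lt_trans dl; rewrite mulr_ge0// ltW.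
have l'0 := lt_trans l0 ll'.
apply: ltr_sum; first by apply/hasP; exists i0 => //; rewrite mem_index_enum.
move=> i _; have /andP[di di0] := d0 i; apply: phi_xi_lt => //.
- by rewrite divr_gt0.
- by rewrite ltr_pM2l// ltf_pV2.
- rewrite mulrA ltr_pdivrMr// mul1r; apply: le_lt_trans dl.
  exact: ler_wpM2l.
Qed.

(* The equation is solved for [k = l^-1]: at [k = dphi tau X / d 0 i0] the largest
   eigenvalue alone contributes [phi tau X >= c], and at [k = 0] the sum vanishes. *)
Lemma lagrange_exists n tau c (d : 'rV[R]_n) (i0 : 'I_n) :
  0 <= tau <= 1 -> 0 < c -> (forall i, 0 < d 0 i <= d 0 i0) ->
  exists l, (1 - tau) * d 0 i0 < l /\ \sum_i phi tau (xi tau (d 0 i / l)) = c.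
Proof.
move=> tau01 c0 d0; have d00 : 0 < d 0 i0 by case/andP: (d0 i0).
have t1 : 0 <= 1 - tau by rewrite subr_ge0; case/andP: tau01.
have [X X1 cX] := phi_unbounded tau01 c; have X0 := lt_trans ltr01 X1.
(* The tangent at [X] lies below [phi tau 1 = 0] at 1, while [phi tau X] is at least [c > 0] and
   [X > 1]. *)
have dX : 0 < dphi tau X.
  have := phi_tangent tau01 ltr01 X0; rewrite phi1// => h.
  have : 0 < dphi tau X * (X - 1) by move: h c0 cX; lra.
  by rewrite pmulr_lgt0// subr_gt0.
pose k2 := dphi tau X / d 0 i0; have k20 : 0 < k2 by rewrite divr_gt0.
pose H k := \sum_i phi tau (xi tau (d 0 i * k)).
have dom i k : 0 <= k <= k2 -> (1 - tau) * (d 0 i * k) < 1.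
  move=> /andP[k0 kk2]; apply: le_lt_trans (dphi_dom tau01 X0).
  apply: ler_wpM2l => //; have -> : dphi tau X = d 0 i0 * k2 by rewrite mulrC divfK ?gt_eqF.
  by have /andP[di ?] := d0 i; apply: ler_pM => //; exact: ltW.
have H0 : H 0 = 0 by rewrite /H big1// => i _; rewrite mulr0 xi0 phi1.
have H2 : c <= H k2.
  rewrite /H (bigD1 i0)//= mulrC divfK ?gt_eqF// xi_dphi//.
  apply: le_trans cX _; rewrite lerDl sumr_ge0// => i _.
  by apply: phi_xi_ge0 => //; apply: dom; rewrite lexx ltW.
have [||k + Hk] := @IVT R H 0 k2 c (ltW k20).
- apply: continuous_in_subspaceT => k; rewrite inE/= in_itv/= => kk.
  apply: continuous_sum_fun => i.
  apply: (@continuous_comp _ _ _ (fun k => d 0 i * k) (phi tau \o xi tau)).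
    by apply: cvgM => //; exact: cvg_cst.
  by apply: continuous_phi_xi => //; exact: dom.
- by rewrite H0 ge_min le_max (ltW c0) H2 orbT.
rewrite in_itv/= => kk; have k0 : 0 < k.
  rewrite lt_neqAle; case/andP: (kk) => -> _; rewrite andbT.
  by apply: contraTneq c0 => k0; rewrite -Hk -k0 H0 ltxx.
exists k^-1; split.
  by rewrite -[ltRHS]mul1r ltr_pdivlMr// -mulrA dom.
by rewrite -[RHS]Hk; apply: eq_bigr => i _; rewrite invrK.
Qed.

End Spectrum.

(** * The robust estimator *)

(** [LP^T *m LP] and [LP *m LP^T] share the spectrum [mu], and [invmx LP *m Q] diagonalizes the
    former. The outer factors supply one more [mu], and the result no longer depends on [LP]. *)
Lemma Pformula_eig (R : realType) n tau lam (Q LP : 'M[R]_n) (mu : 'rV[R]_n) :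
  Q *m Q^T = 1%:M -> posdef (LP *m LP^T) -> LP *m LP^T = Q *m diag_mx mu *m Q^T ->
  Pformula tau lam LP =
  Q *m diag_mx (\row_i (mu 0 i * xi tau (mu 0 i / lam))) *m Q^T.
Proof.
move=> QQ pP PE; have [uQ uQt] := mulmx1_unit QQ.
have uL : LP \in unitmx by have := posdef_unit pP; rewrite unitmx_mul => /andP[].
have [V VE] : exists V, V = invmx LP *m Q by exists (invmx LP *m Q).
have uV : V \in unitmx by rewrite VE unitmx_mul unitmx_inv uL.
have LV : LP *m V = Q by rewrite VE mulKVmx.
have LtE : LP^T = V *m diag_mx mu *m Q^T by rewrite -[LHS](mulKmx uL) PE VE !mulmxA.
have LLV : LP^T *m LP = V *m diag_mx mu *m invmx V.
  apply: (can_inj (mulmxK uV)); rewrite mulmxKV// -[LHS]mulmxA LV LtE.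
  by rewrite -(mulmxA _ Q^T) (mulmx1C QQ) mulmx1.
have VLP : invmx V *m LP^T = diag_mx mu *m Q^T by rewrite LtE -mulmxA mulKmx.
have fE f : LP *m mxfun f (V *m diag_mx mu *m invmx V) *m LP^T =
    Q *m diag_mx (\row_i (mu 0 i * f (mu 0 i))) *m Q^T.
  rewrite mxfunE// !mulmxA LV -(mulmxA _ (invmx V)) VLP mulmxA.
  rewrite -[_ *m diag_mx mu](mulmxA Q) mulmx_diag.
  by congr (_ *m diag_mx _ *m _); apply/rowP => i; rewrite !mxE mulrC.
have aff (f : R -> R) (a b : R) : mxfun f (a%:M + b *: (LP^T *m LP)) =
    mxfun (fun t => f (a + b * t)) (V *m diag_mx mu *m invmx V).
  have -> : a%:M + b *: (LP^T *m LP) = V *m diag_mx (\row_i (a + b * mu 0 i)) *m invmx V.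
    rewrite LLV; have -> : diag_mx (\row_i (a + b * mu 0 i)) = a%:M + b *: diag_mx mu.
      by apply/matrixP => i j; rewrite !mxE; case: eqP; rewrite ?mulr1n ?mulr0n ?mulr0 ?addr0.
    by rewrite mulmxDr mulmxDl mul_mx_scalar -scalemxAl mulmxV// scalemx1 -scalemxAr -scalemxAl.
  by rewrite !mxfunE//; congr (_ *m diag_mx _ *m _); apply/rowP => i; rewrite !mxE.
rewrite /Pformula /mxpow /mxexp /xi; case: ifP => _.
  rewrite -scaleNr (aff (fun t => t `^ (tau - 1)^-1)) fE; congr (_ *m diag_mx _ *m _); apply/rowP => i.
  by rewrite !mxE mulNr mulrAC mulrA.
rewrite -[X in mxfun _ X]add0r -[X in X + _](raddf0 (@scalar_mx R n)) aff fE.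
by congr (_ *m diag_mx _ *m _); apply/rowP => i; rewrite !mxE add0r [_^-1 * _]mulrC.
Qed.

Lemma sqn0 (R : realType) k : sqn (0 : 'cV[R]_k) = 0.
Proof. by rewrite /sqn mulmx0 mxE. Qed.

Lemma congr_invmxK (R : realType) k (K S : 'M[R]_k) : S \in unitmx ->
  S *m (invmx S *m K *m (invmx S)^T) *m S^T = K.
Proof.
by move=> uS; rewrite -!mulmxA -trmx_mul mulmxV// trmx1 mulmx1 mulKVmx.
Qed.

Lemma gram_sqn (R : realType) k l (B : 'M[R]_(l, k)) (S : 'M[R]_k) (u : 'cV[R]_k) :
  sqn (B *m (S *m u)) = (u^T *m ((B *m S)^T *m (B *m S)) *m u) 0 0.
Proof. by rewrite /sqn !trmx_mul !mulmxA. Qed.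

Lemma gram_trace (R : realType) k l (B : 'M[R]_(l, k)) (S N : 'M[R]_k) :
  \tr (B *m (S *m N *m S^T) *m B^T) = \tr ((B *m S)^T *m (B *m S) *m N).
Proof. by rewrite -(mulmxA (B *m S)^T) [RHS]mxtrace_mulC trmx_mul !mulmxA. Qed.

Section Robust.
Variables (R : realType) (n p : nat).
Variables (mx : 'cV[R]_n) (my : 'cV[R]_p).
Variables (Kx : 'M[R]_n) (Kxy : 'M[R]_(n, p)) (Kyx : 'M[R]_(p, n)) (Ky : 'M[R]_p).
Hypothesis pK : posdef (block_mx Kx Kxy Kyx Ky).
Let mz := col_mx mx my.
Let G := Kxy *m invmx Ky.
Let g0 := fun y : 'cV[R]_p => G *m (y - my) + mx.
Let B : 'M[R]_(n, n + p) := row_mx 1%:M (- G).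

(** Centring at an arbitrary [m] isolates the bias [B *m (m - mz)] of the estimator under a shifted
    mean. *)
Lemma err_lin z m : usubmx z - g0 (dsubmx z) = B *m (z - m) + B *m (m - mz).
Proof.
rewrite -mulmxDr addrA subrK -[in RHS](vsubmxK z) /mz /B opp_col_mx add_col_mx mul_row_col mul1mx.
by rewrite mulNmx /g0 opprD addrA addrAC.
Qed.

Lemma Jcost_g0 mt Kt : posdef Kt ->
  Jcost mt Kt g0 = (sqn (B *m (mt - mz)) + \tr (B *m Kt *m B^T))%:E.
Proof.
move=> pKt; rewrite -[X in X%:E]mul1r -(gexp_sqn mt)//.
by apply: eq_lebint => z; rewrite mul1r (err_lin z mt).
Qed.

(** [B] undoes the shear and keeps the first block; [G] involves only [Kxy] and [Ky], so this works
    for every [Ktx]. *)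
Lemma cov_err (Ktx : 'M[R]_n) : posdef (block_mx Ktx Kxy Kyx Ky) ->
  B *m block_mx Ktx Kxy Kyx Ky *m B^T = Ktx - Kxy *m invmx Ky *m Kyx.
Proof.
move=> pKt; rewrite (posdef_block_shear pKt) -/G.
have BU : B *m ushear G = row_mx 1%:M 0.
  by rewrite mul_row_block !mulmx1 !mulmx0 !mul1mx addr0 subrr.
rewrite !mulmxA BU -mulmxA -trmx_mul BU mul_row_block !mulmx0 !mul0mx !addr0 mul1mx.
by rewrite tr_row_mx mul_row_col trmx1 mulmx1 trmx0 mulmx0 addr0.
Qed.

Lemma err_moments (Ktx : 'M[R]_n) (i j : 'I_n) : posdef (block_mx Ktx Kxy Kyx Ky) ->
  gexp mz (block_mx Ktx Kxy Kyx Ky) (fun z => (usubmx z - g0 (dsubmx z)) i 0) = 0%E /\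
  gexp mz (block_mx Ktx Kxy Kyx Ky) (fun z => (usubmx z - g0 (dsubmx z)) i 0 *
      (usubmx z - g0 (dsubmx z)) j 0) = ((Ktx - Kxy *m invmx Ky *m Kyx) i j)%:E.
Proof.
move=> pKt; set Kt := block_mx _ _ _ _ in pKt *.
have errE z l : (usubmx z - g0 (dsubmx z)) l 0 = (row l B *m (z - mz)) 0 0.
  by rewrite (err_lin z mz) subrr mulmx0 addr0 -row_mul [RHS]mxE.
split.
  rewrite -[RHS](_ : (0 + \tr ((0 : 'M[R]_(n + p)) *m Kt))%:E = _); last first.
    by rewrite mul0mx mxtrace0 addr0.
  rewrite -(gexp_quad mz 0 (row i B)^T 0 pKt); apply: eq_lebint => z; congr (_ * _)%:E.
  by rewrite errE trmxK mulmx0 mul0mx add0r [X in _ = _ + X]mxE addr0.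
rewrite -cov_err// -/Kt; transitivity (0 + \tr ((row j B)^T *m row i B *m Kt))%:E; last first.
  rewrite add0r -mulmxA mxtrace_mulC /mxtrace big_ord1 -row_mul.
  congr (_%:E); rewrite [LHS]mxE [RHS]mxE; apply: eq_bigr => l _.
  by congr (_ * _); [rewrite [LHS]mxE|rewrite !mxE].
rewrite -(gexp_quad mz 0 0 ((row j B)^T *m row i B) pKt); apply: eq_lebint => z; congr (_ * _)%:E.
rewrite !errE trmx0 mul0mx add0r [X in _ = X + _]mxE add0r !mulmxA -trmx_mul.
by rewrite -mulmxA [RHS]mxE big_ord1 [X in _ = X * _]mxE mulrC.
Qed.

Lemma estimators_g0 tau c : estimators tau c mz (block_mx Kx Kxy Kyx Ky) g0.
Proof.
split; first exact: borel_affine.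
move=> mt Kt [pKt _]; pose A : 'M[R]_(n, n + p) := row_mx 0 G.
rewrite (_ : gexp _ _ _ = gexp mt Kt (fun z =>
   1 * sqn (A *m (z - mt) + (G *m (dsubmx mt - my) + mx)))).
  by rewrite gexp_sqn// ltry.
apply: eq_lebint => z; rewrite mul1r addrA; congr ((sqn (_ + _) * _)%:E).
have -> : A *m (z - mt) = G *m (dsubmx z - dsubmx mt).
  rewrite -{1}(vsubmxK z) -{1}(vsubmxK mt) opp_col_mx add_col_mx mul_row_col.
  by rewrite mul0mx add0r.
by rewrite -mulmxDr addrA subrK.
Qed.

(* For fixed [y] the integral over [x] has a closed form, which leaves a pointwise
   comparison of nonnegative functions of [y]. *)
Lemma Jcost_bayes (Ktx : 'M[R]_n) g : posdef (block_mx Ktx Kxy Kyx Ky) ->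
  (Jcost mz (block_mx Ktx Kxy Kyx Ky) g0 <= Jcost mz (block_mx Ktx Kxy Kyx Ky) g)%E.
Proof.
move=> pKt; have pP := posdef_schur pKt; have pY := posdef_dr pKt.
rewrite Jcost_g0// subrr mulmx0 sqn0 add0r cov_err//.
set P := Ktx - _ in pP *.
(* Writing the constant as an expectation turns both sides into integrals over y. *)
have -> : (\tr P)%:E = gexp my Ky (fun=> \tr P).
  transitivity (\tr P + \tr (0 *m Ky))%:E; first by rewrite mul0mx mxtrace0 addr0.
  rewrite -(gexp_quad my (\tr P) 0 0 pY); apply: eq_lebint => y; congr (_ * _)%:E.
  by rewrite trmx0 mulmx0 !mul0mx !mxE !addr0.
have trP : 0 <= \tr P.
  have [S [d [uS d0 _ ->]]] := simdiag pP pP.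
  rewrite mxtrace_mulC mulmxA mxtrace_mulC; apply: sumr_ge0 => i _.
  rewrite mul_diag_mx mxE; apply: mulr_ge0; first exact: ltW.
  by rewrite mxE; apply: sumr_ge0 => j _; rewrite mxE -expr2 sqr_ge0.
rewrite /Jcost /gexp lebint_block; apply: le_lebint => y.
  by rewrite lee_fin mulr_ge0// ltW// gauss_gt0.
(* [m'] is the conditional mean, equal to [g0 y]; the inner integral is
   [gy * (sqn (m' - g y) + \tr P)]. *)
set m' := mx + G *m (y - my); set gy := gauss my Ky y.
have gy0 : 0 <= gy by rewrite ltW// gauss_gt0.
have -> : lebint (fun x => (sqn (usubmx (col_mx x y) - g (dsubmx (col_mx x y))) *
    gauss mz (block_mx Ktx Kxy Kyx Ky) (col_mx x y))%:E) =
    gexp m' P (fun x => gy * sqn (1%:M *m (x - m') + (m' - g y))).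
  apply: eq_lebint => x; rewrite gauss_block// -/G -/m' -/P -/gy col_mxKu col_mxKd.
  by rewrite mul1mx addrA subrK; congr (_%:E); ring.
rewrite gexp_sqn// mul1mx trmx1 mulmx1 lee_fin mulrC ler_wpM2l//.
by rewrite lerDr sqn_ge0.
Qed.

(** * The least favorable covariance and the bound over the ball *)

Variables (Q : 'M[R]_n) (mu : 'rV[R]_n).
Hypothesis QQ : Q *m Q^T = 1%:M.
Hypothesis mu0 : forall i, 0 < mu 0 i.
Hypothesis PE : Kx - Kxy *m invmx Ky *m Kyx = Q *m diag_mx mu *m Q^T.
Variable SY : 'M[R]_p.
Hypothesis KyE : Ky = SY *m SY^T.

(** A square root of the nominal covariance adapted to the cost: error along the eigenvectors of P,
    then y. *)
Let S0 : 'M[R]_(n + p) := ushear G *m block_mx (Q *m diag_mx (map_mx Num.sqrt mu)) 0 0 SY.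
Let Pt (x : 'rV[R]_n) := Q *m diag_mx (\row_i (mu 0 i * x 0 i)) *m Q^T.
Let Kt (x : 'rV[R]_n) := block_mx (Pt x + Kxy *m invmx Ky *m Kyx) Kxy Kyx Ky.
(** The entries 1 leave [Ky] and the cross covariance unperturbed and contribute [phi tau 1 = 0] to
    the divergence. *)
Let ext (x : 'rV[R]_n) : 'rV[R]_(n + p) := row_mx x (const_mx 1).

Lemma Kt_diag x : Kt x = S0 *m diag_mx (ext x) *m S0^T.
Proof.
have [_ _ sYX sY] := posdef_block_sym pK; have uY := posdef_unit (posdef_dr pK).
rewrite /S0 trmx_mul !mulmxA -!(mulmxA (ushear G)) mulmxA.
rewrite (_ : block_mx _ _ _ _ *m _ *m _ = block_mx (Pt x) 0 0 Ky).
  rewrite block_shear /G trmx_mul trmx_inv sY sYX !mulmxA mulmxKV// mulmxV// mul1mx.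
  by [].
rewrite diag_mx_row tr_block_mx !trmx0 !mulmx_block !mulmx0 !mul0mx !addr0 !add0r.
rewrite diag_const_mx mulmx1 -KyE trmx_mul tr_diag_mx -!mulmxA (mulmxA (diag_mx _)).
rewrite !mulmx_diag (mulmxA (diag_mx _)) mulmx_diag !mul0mx; congr block_mx.
rewrite /Pt -mulmxA; congr (_ *m (diag_mx _ *m _)); apply/rowP => i; rewrite !mxE.
by rewrite mulrAC -expr2 sqr_sqrtr// ltW.
Qed.

Lemma Kz_gram : block_mx Kx Kxy Kyx Ky = S0 *m S0^T.
Proof.
have e1 : diag_mx (ext (const_mx 1)) = 1%:M.
  by rewrite diag_mx_row !diag_const_mx -scalar_mx_block.
have := Kt_diag (const_mx 1); rewrite e1 mulmx1 => <-; rewrite /Kt; congr block_mx.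
rewrite -[LHS](subrK (Kxy *m invmx Ky *m Kyx)) PE; congr (_ + _).
by congr (_ *m diag_mx _ *m _); apply/rowP => i; rewrite !mxE mulr1.
Qed.

Lemma S0_unit : S0 \in unitmx.
Proof. by have := posdef_unit pK; rewrite Kz_gram unitmx_mul => /andP[]. Qed.

Lemma ext_gt0 (x : 'rV[R]_n) : (forall i, 0 < x 0 i) -> forall i, 0 < ext x 0 i.
Proof.
by move=> x0 i; rewrite /ext; case: (split_ordP i) => j ->; rewrite ?row_mxEl ?row_mxEr ?mxE.
Qed.

Lemma Kt_posdef (x : 'rV[R]_n) : (forall i, 0 < x 0 i) -> posdef (Kt x).
Proof.
by move=> x0; rewrite Kt_diag; apply: posdef_congr S0_unit; apply/posdef_diag/ext_gt0.
Qed.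

Lemma Ddiv_Kt tau (x : 'rV[R]_n) : 0 <= tau <= 1 -> (forall i, 0 < x 0 i) ->
  Ddiv tau mz (Kt x) mz (block_mx Kx Kxy Kyx Ky) = (\sum_i phi tau (x 0 i))%:E.
Proof.
move=> tau01 x0; rewrite Kt_diag Kz_gram Ddiv_eig ?S0_unit//; last exact: ext_gt0.
rewrite eqxx orbT subrr mulmx0 sqn0 mulr0 add0r big_split_ord/=.
congr (_%:E); rewrite [X in _ + X]big1 ?addr0.
  by apply: eq_bigr => i _; rewrite row_mxEl.
by move=> i _; rewrite row_mxEr mxE phi1.
Qed.

Lemma BS0 : B *m S0 = row_mx (Q *m diag_mx (map_mx Num.sqrt mu)) 0.
Proof.
rewrite /S0 mulmxA mul_row_block !mulmx1 !mulmx0 !mul1mx addr0 subrr.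
by rewrite mul_row_block !mulmx0 !mul0mx !addr0 mul1mx.
Qed.

Lemma BS0_gram : (B *m S0)^T *m (B *m S0) = diag_mx (row_mx mu 0).
Proof.
rewrite BS0 tr_row_mx mul_col_row trmx0 !mulmx0 !mul0mx diag_mx_row.
rewrite trmx_mul -mulmxA (mulmxA Q^T) (mulmx1C QQ) mul1mx tr_diag_mx mulmx_diag.
rewrite (_ : diag_mx 0 = 0); last by apply/matrixP => i j; rewrite !mxE mul0rn.
by congr (block_mx (diag_mx _)); apply/rowP => i; rewrite !mxE -expr2 sqr_sqrtr// ltW.
Qed.

Let xs tau lam : 'rV[R]_n := \row_i xi tau (mu 0 i / lam).

Lemma Jcost_ball_le tau c lam mt Kt' :
  0 <= tau <= 1 -> 0 < lam -> (forall i, (1 - tau) * mu 0 i < lam) ->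
  c = \sum_i phi tau (xi tau (mu 0 i / lam)) ->
  inBall tau c mz (block_mx Kx Kxy Kyx Ky) mt Kt' ->
  (Jcost mt Kt' g0 <= Jcost mz (Kt (xs tau lam)) g0)%E.
Proof.
move=> tau01 lam0 mulam cE [pKt' Dc].
have dom i : (1 - tau) * (mu 0 i / lam) < 1 by rewrite mulrA ltr_pdivrMr// mul1r.
rewrite /xs; set x := \row_i _; have x0 i : 0 < x 0 i by rewrite mxE xi_gt0.
have -> : Jcost mz (Kt x) g0 = (\tr (Pt x))%:E.
  rewrite Jcost_g0; last exact: Kt_posdef.
  rewrite cov_err ?addrK; last exact: Kt_posdef.
  by rewrite subrr mulmx0 sqn0 add0r.
rewrite Jcost_g0// lee_fin.
have := @ball_bound R (n + p) tau lam c mt mz Kt' S0 (row_mx mu 0) (ext x).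
rewrite -Kz_gram => /(_ tau01 lam0 S0_unit (ext_gt0 x0)) bnd.
apply: le_trans (le_trans (bnd _ pKt' Dc _) _).
- set u := invmx S0 *m _; set N := invmx S0 *m Kt' *m _.
  have -> : mt - mz = S0 *m u by rewrite mulKVmx// S0_unit.
  by rewrite -[Kt' in _ *m Kt' *m _](congr_invmxK _ S0_unit) gram_sqn gram_trace BS0_gram.
(* Stationarity: [xi] inverts [dphi] on the error coordinates, and on the y-coordinates both sides
   vanish because [xi tau 0 = 1]. *)
- move=> j; rewrite /ext; case: (split_ordP j) => i ->.
    by rewrite !row_mxEl mxE dphi_xi// mulrC divfK// gt_eqF.
  by rewrite !row_mxEr !mxE -(xi0 tau) dphi_xi ?mulr0.
- rewrite cE /ext big_split_ord/= [X in _ = _ + X]big1 ?addr0.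
    by apply: eq_bigr => i _; rewrite row_mxEl mxE.
  by move=> i _; rewrite row_mxEr mxE phi1.
- rewrite /Pt mxtrace_mulC mulmxA (mulmx1C QQ) mul1mx mxtrace_diag big_split_ord/=.
  rewrite [X in _ + X]big1 ?addr0.
    by apply: ler_sum => i _; rewrite /ext !row_mxEl !mxE.
  by move=> i _; rewrite row_mxEr mxE mul0r.
Qed.

End Robust.

Unset Implicit Arguments.

Theorem theorem1 (R : realType) (n p : nat) (tau c : R)
  (mx : 'cV[R]_n) (my : 'cV[R]_p)
  (Kx : 'M[R]_n) (Kxy : 'M[R]_(n, p)) (Kyx : 'M[R]_(p, n)) (Ky : 'M[R]_p) :
  (0 < n)%N -> (0 < p)%N -> 0 <= tau <= 1 -> 0 < c ->
  posdef (block_mx Kx Kxy Kyx Ky) ->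
  let mz := col_mx mx my in
  let Kz := block_mx Kx Kxy Kyx Ky in
  let G0 := Kxy *m invmx Ky in
  let g0 := fun y : 'cV[R]_p => G0 *m (y - my) + mx in
  let P := Kx - Kxy *m invmx Ky *m Kyx in
  let Kt_of := fun Ptx : 'M[R]_n =>
    block_mx (Ptx + Kxy *m invmx Ky *m Kyx) Kxy Kyx Ky in
  exists Ktx : 'M[R]_n,
    let Kt0 := block_mx Ktx Kxy Kyx Ky in
    let Pt := Ktx - Kxy *m invmx Ky *m Kyx in
    let err := fun z : 'cV[R]_(n + p) => usubmx z - g0 (dsubmx z) in
    [/\ (* f~° is in the ball and g° is an admissible estimator *)
        inBall tau c mz Kz mz Kt0,
        estimators tau c mz Kz g0,
        (* saddle point: f~° least favorable, g° optimal against it *)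
        (forall mt Kt, inBall tau c mz Kz mt Kt ->
            (Jcost mt Kt g0 <= Jcost mz Kt0 g0)%E)
        /\ (forall g, estimators tau c mz Kz g ->
            (Jcost mz Kt0 g0 <= Jcost mz Kt0 g)%E),
        (* minimax optimality of g° *)
        (forall g, estimators tau c mz Kz g ->
          (worst_case tau c mz Kz g0 <= worst_case tau c mz Kz g)%E) &
        ((* the estimation error: zero mean, covariances P and Pt *)
        (forall i j : 'I_n,
          [/\ gexp mz Kz (fun z => err z i 0) = 0%E,
              gexp mz Kt0 (fun z => err z i 0) = 0%E,
              gexp mz Kz (fun z => err z i 0 * err z j 0) = (P i j)%:E &
              gexp mz Kt0 (fun z => err z i 0 * err z j 0) = (Pt i j)%:E]) /\
        (* the formula for Pt with the unique Lagrange multiplier lambda *)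
        exists lam : R,
          [/\ (1 - tau) * specnorm P < lam,
              Ddiv tau mz Kt0 mz Kz = c%:E &
              forall LP : 'M[R]_n, P = LP *m LP^T ->
                Pt = Pformula tau lam LP /\
                (forall lam' : R, (1 - tau) * specnorm P < lam' ->
                   Ddiv tau mz (Kt_of (Pformula tau lam' LP)) mz Kz = c%:E ->
                   lam' = lam)])].
Proof.
move=> n0 p0 tau01 c0 pK mz Kz G0 g0 P Kt_of.
have pP : posdef P := posdef_schur pK.
(* Spectral decomposition of [P]. *)
have [Q [mu [uQ mu0 QQ' PE]]] := simdiag (posdef1 R n) pP.
have QQ := esym QQ'.
have [SY [_ [_ _ KyE _]]] := simdiag (posdef_dr pK) (posdef_dr pK).
have [i0 mumax] : exists i0, forall i, mu 0 i <= mu 0 i0.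
  have [i _ imax] := @arg_maxP _ _ _ (Ordinal n0) xpredT (fun i => mu 0 i) isT.
  by exists i => j; exact: imax.
have mumax' i : 0 < mu 0 i <= mu 0 i0 by rewrite mu0 mumax.
have specP : specnorm P = mu 0 i0.
  by rewrite PE; apply: specnorm_diag => // i; rewrite (ltW (mu0 i)) mumax.
have t1 : 0 <= 1 - tau by rewrite subr_ge0; case/andP: tau01.
have domP l : (1 - tau) * mu 0 i0 < l ->
    [/\ 0 < l, forall i, (1 - tau) * mu 0 i < l &
        forall i, (1 - tau) * (mu 0 i / l) < 1].
  move=> ml; have l0 : 0 < l by apply: le_lt_trans ml; rewrite mulr_ge0// ltW.
  have mul i : (1 - tau) * mu 0 i < l by apply: le_lt_trans ml; rewrite ler_wpM2l.
  by split=> // i; rewrite mulrA ltr_pdivrMr// mul1r.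
have [lam [lamgt sumc]] := lagrange_exists tau01 c0 mumax'.
have [lam0 mulam dom] := domP _ lamgt.
pose xs l : 'rV[R]_n := \row_i xi tau (mu 0 i / l).
have xs0 l : (1 - tau) * mu 0 i0 < l -> forall i, 0 < xs l 0 i.
  by move=> /domP[_ _ doml] i; rewrite mxE xi_gt0.
pose Pt l := Q *m diag_mx (\row_i (mu 0 i * xs l 0 i)) *m Q^T.
have pKt l : (1 - tau) * mu 0 i0 < l -> posdef (Kt_of (Pt l)).
  by move=> ll; exact: (Kt_posdef pK mu0 PE KyE (xs0 _ ll)).
have DKt l : (1 - tau) * mu 0 i0 < l ->
    Ddiv tau mz (Kt_of (Pt l)) mz Kz = (\sum_i phi tau (xi tau (mu 0 i / l)))%:E.
  move=> ll; rewrite (Ddiv_Kt mx my pK mu0 PE KyE tau01 (xs0 _ ll)).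
  by congr (_%:E); apply: eq_bigr => i _; rewrite mxE.
have pKt0 := pKt _ lamgt.
have D0 : Ddiv tau mz (Kt_of (Pt lam)) mz Kz = c%:E by rewrite DKt// sumc.
have ball0 : inBall tau c mz Kz mz (Kt_of (Pt lam)) by split=> //; rewrite D0.
have saddle1 mt Kt : inBall tau c mz Kz mt Kt ->
    (Jcost mt Kt g0 <= Jcost mz (Kt_of (Pt lam)) g0)%E.
  exact: (Jcost_ball_le pK QQ mu0 PE KyE tau01 lam0 mulam (esym sumc)).
have saddle2 g : (Jcost mz (Kt_of (Pt lam)) g0 <= Jcost mz (Kt_of (Pt lam)) g)%E.
  exact: Jcost_bayes.
exists (Pt lam + Kxy *m invmx Ky *m Kyx); cbv zeta.
split=> //.
- exact: estimators_g0.
(* The saddle value separates the worst cases: it bounds that of [g0] from above and that of [g]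
   from below. *)
- move=> g eg; apply: (@le_trans _ _ (Jcost mz (Kt_of (Pt lam)) g0)).
    by apply: ge_ereal_sup => _ [mt [Kt [bKt ->]]]; exact: saddle1.
  apply: le_trans (saddle2 g) _; apply: ereal_sup_ubound.
  by exists mz, (Kt_of (Pt lam)).
- split.
    move=> i j; have [e1 e2] := err_moments mx my i j pK.
    by have [e3 e4] := err_moments mx my i j pKt0.
  exists lam; rewrite specP; split=> // LP PLP.
  (* Every factor [LP] yields the same covariance, so uniqueness reduces to strict monotonicity of
     the divergence in the multiplier. *)
  have PfE l : Pformula tau l LP = Pt l.
    rewrite (@Pformula_eig _ _ tau l Q LP mu QQ) -?PLP//.
    by congr (_ *m diag_mx _ *m _); apply/rowP => i; rewrite !mxE.
  rewrite addrK PfE; split=> // l ll; rewrite PfE DKt// => -[sumc'].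
  apply/eqP; case: ltgtP => // h.
    have := lagrange_uniq tau01 mumax' ll h; rewrite sumc' sumc ltxx//.
  have := lagrange_uniq tau01 mumax' lamgt h; rewrite sumc' sumc ltxx//.
Qed.
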